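(* Let $d\ge 1$ and $\Gamma:=\{(Q,k): Q\in\mathcal{D}_d,\ 1\leq k<2^d\}$. There are positive constants $C(d)$ and $c(d)$, depending only on $d$, so that the following is true. Let $\psi\in L^1(\mathbf{R}^d)$ be non-negative, with support contained in $[-1,1]^d$ and $\int\psi\,dx=1$. For arbitrary but fixed $0<\eta<1/2$, and for every $Q\in\mathcal{D}_d$ and $1\leq k<2^d$, define $$\phi_{(Q),k}(x):=(h_{(Q),k}*\psi_{\eta\ell(Q)})(x).$$ Then $$\left\Vert\left\{h_{(Q),k}-\phi_{(Q),k}\right\}_{(Q,k)\in\Gamma}\right\Vert_{AO(\Gamma)}<C(d)\,\eta^{1/2},$$ and the family $\{\phi_{(Q),k}\}_{(Q,k)\in\Gamma}$ satisfies: (a) $\mathrm{supp}\,\phi_{(Q),k}\subset(1+2\eta)Q$; (b) $\phi_{(Q),k}=h_{(Q),k}$ at points whose distance from the discontinuities of $h_{(Q),k}$ is $>c(d)\,\eta\,\ell(Q)$; (c) if $Q=\prod_{i=1}^d[j_i2^n,(j_i+1)2^n)$ with $n,j_1,\dots,j_d$ integers, then, with $Q_0:=[0,1)^d$, $$\phi_{(Q),k}(x_1,\ldots,x_d)=2^{-nd/2}\phi_{(Q_0),k}(2^{-n}x_1-j_1,\,2^{-n}x_2-j_2,\,\ldots,\,2^{-n}x_d-j_d).$$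
   Context: Bessel families: a family $\{\psi_\gamma\}_{\gamma\in\Gamma}\subset L^2(\mathbf{R}^d)$ is a Bessel family if there is $0\le B<\infty$ with $\sum_{\gamma\in\Gamma}|\langle f,\psi_\gamma\rangle|^2\leq B\Vert f\Vert_2^2$ for all $f\in L^2(\mathbf{R}^d)$, where $\langle f,g\rangle=\int f\overline{g}\,dx$; the minimal such $B$ is the optimal bound. $AO(\Gamma)$ is the vector space of Bessel families indexed by $\Gamma$, and $\Vert\{\psi_\gamma\}_{\gamma\in\Gamma}\Vert_{AO(\Gamma)}$ is the square root of the optimal bound. A bound on the $AO(\Gamma)$ norm includes the assertion that the family is Bessel. Dyadic cubes: a dyadic interval is an interval $[j2^n,(j+1)2^n)$ with $j,n$ integers. A cube $Q=\prod_{i=1}^dI_i(Q)\subset\mathbf{R}^d$ is a product of $d$ half-open intervals $[a,b)$ of the same length $\ell(Q)$; $x_Q$ is its center and $|Q|$ its Lebesgue measure. $Q$ is dyadic if all $I_i(Q)$ are dyadic; $\mathcal{D}_d$ is the set of dyadic cubes in $\mathbf{R}^d$. For $\lambda>0$, $\lambda Q$ is the $\lambda$-fold expansion of $Q$ centered at $x_Q$. The inclusion $\mathrm{supp}\,\phi\subset(1+2\eta)Q$ means that $\phi$ vanishes outside $(1+2\eta)Q$. Haar functions: for a dyadic interval $I$ with left and right halves $I_l,I_r$, $h^{(I)}:=\chi_{I_l}-\chi_{I_r}$. For $Q_0=[0,1)^d$, let $h^{(Q_0),k}$, $1\le k<2^d$, be a fixed enumeration of the $2^d-1$ functions $\prod_{i=1}^dg_i(x_i)$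 where each $g_i$ is either $h^{([0,1))}$ or $\chi_{[0,1)}$ and not all $g_i$ equal $\chi_{[0,1)}$. Put $h_{(Q_0),k}:=h^{(Q_0),k}$, and for $Q=\prod_{i=1}^d[j_i2^n,(j_i+1)2^n)$ put $h_{(Q),k}(x_1,\dots,x_d):=2^{-nd/2}h_{(Q_0),k}(2^{-n}x_1-j_1,\dots,2^{-n}x_d-j_d)$. Dilation: for $\delta>0$, $\psi_\delta(x):=\delta^{-d}\psi(x/\delta)$; $*$ is convolution on $\mathbf{R}^d$. *)

(* Defs.v *)
From HB Require Import structures.
From mathcomp Require Import all_boot all_order all_algebra.
From mathcomp Require Import all_classical all_reals all_analysis.
From mathcomp Require Import complex.

Set Implicit Arguments.
Unset Strict Implicit.
Unset Printing Implicit Defensive.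

Import Order.TTheory GRing.Theory Num.Theory.
Import numFieldNormedType.Exports.
Import ComplexField.

Local Open Scope classical_set_scope.
Local Open Scope complex_scope.
Local Open Scope ring_scope.

(* R^d is 'rV[R]_d, with the sigma-algebra generated by the coordinates. *)

Definition measure_row_display : measure_display -> measure_display.
Proof. exact. Qed.

Section measurable_row.
Context d0 (T : sigmaRingType d0) (d : nat).

Let coords : 'I_d -> 'rV[T]_d -> T := fun i x => x ord0 i.

Let row_set0 : g_sigma_preimage coords set0.
Proof. exact: sigma_algebra0. Qed.

Let row_setC A : g_sigma_preimage coords A -> g_sigma_preimage coords (~` A).
Proof. exact: sigma_algebraC. Qed.

Let row_bigcup (F : (set 'rV[T]_d)^nat) :
  (forall i, g_sigma_preimage coords (F i)) ->
  g_sigma_preimage coords (\bigcup_i (F i)).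
Proof. exact: sigma_algebra_bigcup. Qed.

HB.instance Definition _ := @isMeasurable.Build (measure_row_display d0)
  'rV[T]_d (g_sigma_preimage coords) row_set0 row_setC row_bigcup.

End measurable_row.

Lemma measurable_coord d0 (T : sigmaRingType d0) (d : nat) (i : 'I_d) :
  measurable_fun [set: 'rV[T]_d] (fun x => x ord0 i).
Proof.
move=> _ Y mY; rewrite setTI; apply: sub_sigma_algebra => /=.
rewrite -bigcup_seq/=; exists i => /=; first by rewrite mem_index_enum.
by exists Y => //; rewrite setTI.
Qed.

Lemma measurable_fun_rowP d1 d2 (T1 : measurableType d1)
    (T2 : measurableType d2) (d : nat) (f : T1 -> 'rV[T2]_d) :
  (forall i, measurable_fun [set: T1] (fun x => f x ord0 i)) ->
  measurable_fun [set: T1] f.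
Proof.
move=> mf _ A mA; rewrite setTI.
pose P := [set A : set 'rV[T2]_d | measurable (f @^-1` A)].
suff : measurable `<=` P by apply.
rewrite /measurable/=; apply: smallest_sub.
  split; rewrite /P/=.
  - by rewrite preimage_set0.
  - by move=> B mB; rewrite setTD preimage_setC; exact: measurableC.
  - by move=> F mF; rewrite preimage_bigcup; exact: bigcup_measurable.
move=> B; rewrite -bigcup_seq => -[i _ [Y mY <-]]; rewrite /P/= setTI.
by have := mf i measurableT Y mY; rewrite setTI.
Qed.

Section lebesgue_row.
Variable R : realType.

Definition cons_row (d : nat) (p : measurableTypeR R * 'rV[R]_d) :
    'rV[R]_d.+1 :=
  \row_(i < d.+1) (if unlift ord0 i is Some j then p.2 ord0 j else p.1).

Lemma measurable_cons_row d : measurable_fun setT (@cons_row d).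
Proof.
apply: measurable_fun_rowP => i.
case: (unliftP ord0 i) => [j ->|->].
  rewrite [X in measurable_fun _ X](_ : _ = (fun x : 'rV[R]_d => x ord0 j) \o snd);
    last by apply/funext => p; rewrite /= mxE liftK.
  by apply: measurableT_comp => //; exact: measurable_coord.
rewrite [X in measurable_fun _ X](_ : _ = fst) //.
by apply/funext => p; rewrite /= mxE unlift_none.
Qed.

Definition uncons_row (d : nat) (v : 'rV[R]_d.+1) :
    measurableTypeR R * 'rV[R]_d :=
  (v ord0 ord0, \row_(j < d) v ord0 (lift ord0 j)).

Lemma cons_rowK d : cancel (@cons_row d) (@uncons_row d).
Proof.
move=> [a v]; rewrite /uncons_row /cons_row/=; congr pair.
  by rewrite mxE unlift_none.
by apply/rowP => j; rewrite !mxE liftK.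
Qed.

Lemma measurable_uncons_row d : measurable_fun setT (@uncons_row d).
Proof.
apply: measurable_fun_pair; first exact: (@measurable_coord _ R).
apply: measurable_fun_rowP => i.
rewrite [X in measurable_fun _ X](_ : _ = fun v : 'rV[R]_d.+1 => v ord0 (lift ord0 i)).
  exact: (@measurable_coord _ R).
by apply/funext => v; rewrite mxE.
Qed.

Section cons_measure.
Variables (d : nat) (mu : {sigma_finite_measure set 'rV[R]_d -> \bar R}).

Definition cons_measure : set 'rV[R]_d.+1 -> \bar R :=
  pushforward (@lebesgue_measure R \x mu)%E (@cons_row d).

Let cons_measure0 : cons_measure set0 = 0%E.
Proof. by rewrite /cons_measure /pushforward preimage_set0 measure0. Qed.

Let cons_measure_ge0 A : (0 <= cons_measure A)%E.
Proof. by rewrite /cons_measure /pushforward measure_ge0. Qed.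

Let cons_measure_sigma_additive : semi_sigma_additive cons_measure.
Proof.
have mcons := @measurable_cons_row d.
exact: (@measure_semi_sigma_additive _ _ _ (pushforward _ _)).
Qed.

HB.instance Definition _ := isMeasure.Build _ _ _ cons_measure
  cons_measure0 cons_measure_ge0 cons_measure_sigma_additive.

Let cons_measure_sigma_finite : sigma_finite setT cons_measure.
Proof.
have /sigma_finiteP[F [UF ndF Foo]] := sigma_finiteT (@lebesgue_measure R).
have /sigma_finiteP[G [UG ndG Goo]] := sigma_finiteT mu.
exists (fun k => @uncons_row d @^-1` (F k `*` G k)).
  rewrite -preimage_bigcup -(preimage_setT (@uncons_row d)); congr (_ @^-1` _).
  rewrite -setXTT UF UG; apply/seteqP; split => [[x y]|[x y] [k _ []]] /=.
    move=> [[n _ Fnx] [m _ Gmy]]; exists (maxn n m) => //; split.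
      by move: x Fnx; exact/subsetPset/ndF/leq_maxl.
    by move: y Gmy; exact/subsetPset/ndG/leq_maxr.
  by split; exists k.
move=> k; have [mFk Fkoo] := Foo k; have [mGk Gkoo] := Goo k; split.
  rewrite -[X in measurable X]setTI; apply: measurable_uncons_row => //.
  exact: measurableX.
rewrite /cons_measure /pushforward -comp_preimage.
rewrite (_ : _ \o _ = id) ?preimage_id; last exact/funext/cons_rowK.
by rewrite product_measure1E// lte_mul_pinfty// ge0_fin_numE.
Qed.

HB.instance Definition _ := Measure_isSigmaFinite.Build _ _ _ cons_measure
  cons_measure_sigma_finite.

End cons_measure.

Fixpoint lebesgue_row (d : nat) : {sigma_finite_measure set 'rV[R]_d -> \bar R} :=
  match d with
  | 0 => @dirac _ 'rV[R]_0 0 R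
  | d'.+1 => cons_measure (lebesgue_row d')
  end.

Lemma lebesgue_row_box (d : nat) (a b : 'rV[R]_d) :
  (forall i, a ord0 i <= b ord0 i) ->
  lebesgue_row d [set x | forall i, a ord0 i <= x ord0 i < b ord0 i] =
  (\prod_(i < d) (b ord0 i - a ord0 i))%:E.
Proof.
elim: d a b => [|d IH] a b ab.
  by rewrite big_ord0 /= diracE mem_set// => -[].
pose a' := (uncons_row a).2; pose b' := (uncons_row b).2.
pose box := [set x : 'rV[R]_d | forall i, a' ord0 i <= x ord0 i < b' ord0 i].
have mbox : measurable box.
  rewrite (_ : box = \bigcap_(i in [set: 'I_d])
    ((fun x : 'rV[R]_d => x ord0 i) @^-1` `[a' ord0 i, b' ord0 i[)).
    apply: fin_bigcap_measurable => // i _.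
    by rewrite -[X in measurable X]setTI; apply: (@measurable_coord _ R).
  by apply/seteqP; split => x /= h i; [move=> _|];
    have := h i; rewrite /= in_itv/=; apply.
have E : @cons_row d @^-1` [set x | forall i, a ord0 i <= x ord0 i < b ord0 i]
    = `[a ord0 ord0, b ord0 ord0[ `*` box.
  apply/seteqP; split => -[x v] /=.
    move=> h; split; first by have := h ord0; rewrite mxE unlift_none/= in_itv.
    by move=> i; have := h (lift ord0 i); rewrite !mxE liftK.
  move=> [+ h] i; rewrite in_itv/= => x0.
  case: (unliftP ord0 i) => [j ->|->]; rewrite mxE ?unlift_none ?liftK//=.
  by have := h j; rewrite !mxE.
transitivity ((@lebesgue_measure R \x lebesgue_row d)%E
    (`[a ord0 ord0, b ord0 ord0[ `*` box)); first by rewrite -E.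
rewrite product_measure1E//= lebesgue_measure_itv/= lte_fin IH; last first.
  by move=> i; rewrite !mxE.
rewrite big_ord_recl EFinM; congr (_ * _)%E.
  have := ab ord0; rewrite le_eqVlt => /predU1P[->|->]; last by rewrite EFinB.
  by rewrite ltxx subrr.
by congr EFin; apply: eq_bigr => i _; rewrite !mxE.
Qed.

End lebesgue_row.

Section bessel_families.
Variables (R : realType) (d : nat).
Local Notation mu := (lebesgue_row R d).
Local Notation normc := Normc.normc.
Implicit Types f g : 'rV[R]_d -> R[i].

Definition cintegral f : R[i] :=
  (\int[mu]_x complex.Re (f x)) +i* (\int[mu]_x complex.Im (f x)).

Definition L2 : set ('rV[R]_d -> R[i]) :=
  [set f : 'rV[R]_d -> R[i] |
    [/\ measurable_fun setT (fun x : 'rV[R]_d => complex.Re (f x)),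
        measurable_fun setT (fun x : 'rV[R]_d => complex.Im (f x)) &
        (\int[mu]_x ((normc (f x)) ^+ 2)%:E < +oo)%E]].

Definition L2norm2 f : R := \int[mu]_x (normc (f x)) ^+ 2.

Definition inner f g : R[i] := cintegral (fun x => f x * conjc (g x)).

Variable Gamma : choiceType.
Implicit Type psi : Gamma -> 'rV[R]_d -> R[i].

Definition bessel_bound psi (B : R) :=
  0 <= B /\
  forall f, L2 f ->
    (\esum_(c in [set: Gamma]) ((normc (inner f (psi c))) ^+ 2)%:E
      <= (B * L2norm2 f)%:E)%E.

Definition bessel_family psi :=
  (forall c, L2 (psi c)) /\ exists B, bessel_bound psi B.

(* Only meaningful for Bessel families: [inf] takes a junk value when there is
   no Bessel bound. *)
Definition AO_norm psi : R := Num.sqrt (inf [set B | bessel_bound psi B]).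

End bessel_families.

Section haar.
Variables (R : realType) (d : nat).
Implicit Type x : 'rV[R]_d.

(* The pair (n, j) stands for the cube with sides [j_i 2^n, (j_i + 1) 2^n[; this
   encoding of dyadic cubes is one-to-one as soon as 0 < d. *)
Definition dyadic : Type := (int * 'rV[int]_d)%type.

Definition unit_dyadic : dyadic := (0, 0).

Implicit Type Q : dyadic.

Definition side Q : R := 2 ^ Q.1.

Definition cube Q : set 'rV[R]_d :=
  [set x | forall i, (Q.2 ord0 i)%:~R * side Q <= x ord0 i
                     < ((Q.2 ord0 i)%:~R + 1) * side Q].

Definition center Q : 'rV[R]_d :=
  \row_i (((Q.2 ord0 i)%:~R + 2^-1) * side Q).

Definition dilated_cube (lambda : R) Q : set 'rV[R]_d :=
  [set center Q + lambda *: (x - center Q) | x in cube Q].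

Definition to_unit Q x : 'rV[R]_d :=
  \row_i (2 ^ (- Q.1) * x ord0 i - (Q.2 ord0 i)%:~R).

Definition L2_scale Q : R := 2 `^ (- (Q.1%:~R * d%:R) / 2).

Definition chi01 : R -> R := \1_(`[0, 1[%classic).

Definition haar01 : R -> R :=
  fun t => \1_(`[0, 2^-1[%classic) t - \1_(`[2^-1, 1[%classic) t.

Definition haar_products : set ('rV[R]_d -> R) :=
  [set h | exists g : 'I_d -> R -> R,
    [/\ forall i, g i = haar01 \/ g i = chi01,
        ~ (forall i, g i = chi01) &
        h = fun x => \prod_(i < d) g i (x ord0 i)]].

(* Haar functions on a given cube are indexed from 0 to 2^d - 2 instead of from
   1 to 2^d - 1. *)
Definition haar_enumeration (h0 : 'I_(2 ^ d).-1 -> 'rV[R]_d -> R) :=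
  injective h0 /\ range h0 = haar_products.

Definition haar (h0 : 'I_(2 ^ d).-1 -> 'rV[R]_d -> R) Q k x : R :=
  L2_scale Q * h0 k (to_unit Q x).

Definition convolution (f g : 'rV[R]_d -> R) x : R :=
  \int[lebesgue_row R d]_y (f (x - y) * g y).

Definition dilation (delta : R) (psi : 'rV[R]_d -> R) x : R :=
  delta ^- d * psi (delta^-1 *: x).

Definition smooth_haar h0 (psi : 'rV[R]_d -> R) (eta : R) Q k :
    'rV[R]_d -> R :=
  convolution (haar h0 Q k) (dilation (eta * side Q) psi).

Definition discontinuities (f : 'rV[R]_d -> R) : set 'rV[R]_d :=
  [set x | ~ {for x, continuous f}].

Definition euclidean_dist x (y : 'rV[R]_d) : R :=
  Num.sqrt (\sum_(i < d) (x ord0 i - y ord0 i) ^+ 2).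

Definition dist_to_set (A : set 'rV[R]_d) x : R :=
  inf [set euclidean_dist x y | y in A].

End haar.

(* Main.v *)
(* By the scaling of Lebesgue measure, phi_Q(x) is the psi-average over y in
   [-1, 1]^d of h_Q(x - eta l(Q) y). The Bessel inequality being convex, it suffices
   to bound by O(eta), for each fixed y, the Bessel constant of the differences
   g_Q(x) = h_Q(x) - h_Q(x - eta l(Q) y), that is, by duality, the norm of their Gram
   matrix; this is done by a Schur test. All cubes Q' of one scale are handled
   together: they are disjoint, so that the sum of the |<g_Q, g_Q'>| is at most a
   multiple of |Q'|^(-1/2) \int |g_Q|, and, for scales finer than that of Q, at most a
   multiple of |Q'|^(-1/2) \int |g_Q - g_Q(. + eta l(Q') y)|. Both are estimated by
   the L^1 modulus of continuity of h_Q, which gives eta 2^(-|m - n|/2) for the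
   scales 2^m, 2^n once the weights l(Q)^((d - 1)/2) are inserted. *)

Require Import Defs.
From mathcomp Require Import all_boot all_order all_algebra.
From mathcomp Require Import all_classical all_reals all_analysis.
From mathcomp Require Import complex measurable_realfun.
From mathcomp Require Import ring lra zify.

Set Implicit Arguments.
Unset Strict Implicit.
Unset Printing Implicit Defensive.

Import Order.TTheory GRing.Theory Num.Theory.
Import numFieldNormedType.Exports.

Local Open Scope classical_set_scope.
Local Open Scope complex_scope.
Local Open Scope ring_scope.

(** The translation by eta l(Q) y depends on the scale and is not aligned with the dyadic grid, so
    the orthogonality of the Haar functions is lost for the differences g_Q and the Gram matrix is
    summed with absolute values. The smallness comes from L^1: a translation by at most eta l(Q)
    changes h_Q only near its jump hyperplanes, on a set of measure O(eta |Q|). This yields one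
    factor eta in the Bessel bound, hence eta^(1/2) in the norm. As for the weights, let Q have
    scale m. Without them the bound for scale n is a multiple of eta 2^((m - n) d/2) if n > m and of
    eta 2^((m - n)(d/2 - 1)) if n <= m; the second does not decay towards finer scales once d >= 2.
    A weight l(Q)^a makes both decay exactly when d/2 - 1 < a < d/2, and the midpoint a = (d - 1)/2
    gives them the common rate 2^(-|m - n|/2). *)

(** * Affine changes of variables for Lebesgue measure on R^d *)

Section affine_invariance.
Variable R : realType.

Lemma measurable_fun_affine (a b : R) :
  measurable_fun [set: measurableTypeR R]
    (fun x : measurableTypeR R => a * x + b : measurableTypeR R).
Proof. by apply: measurable_funD => //; exact: measurable_funM. Qed.

(** The rescaled pushforward agrees with Lebesgue measure on half-open intervals, which determine
    it. *)
Lemma lebesgue_measure_affine (a b : R) : 0 < a ->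
  forall A : set (measurableTypeR R), measurable A ->
  (a%:E * lebesgue_measure ((fun x => a * x + b)%R @^-1` A))%E =
  lebesgue_measure A.
Proof.
move=> a0 A mA.
pose a' : {nonneg R} := NngNum (ltW a0).
pose m :=
  mscale a' (pushforward (@lebesgue_measure R)
    (fun x : measurableTypeR R => a * x + b : measurableTypeR R)
    : {measure set _ -> \bar R}).
apply/esym/(lebesgue_measure_unique (mu := m (measurable_fun_affine a b))) => //.
move=> _ [[u v] _ <-].
rewrite /m; change (lebesgue_measure `]u, v]%classic =
  a%:E * lebesgue_measure ((fun x : R => a * x + b)%R @^-1` `]u, v]%classic))%E.
rewrite [X in (_ * _ X)%E](_ : _ @^-1` _ =
    `](u - b) / a, (v - b) / a]%classic); last first.
  apply/seteqP; split => x /=; rewrite !in_itv/=.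
    by rewrite ltr_pdivrMr// ler_pdivlMr// ltrBlDr lerBrDr [x * a]mulrC.
  by rewrite ltr_pdivrMr// ler_pdivlMr// ltrBlDr lerBrDr [x * a]mulrC.
rewrite !lebesgue_measure_itv/= !lte_fin ltr_pM2r ?invr_gt0// ltrD2r.
case: ifPn => uv; last by rewrite mule0.
by rewrite -!EFinB -EFinM; congr EFin; field; rewrite gt_eqF.
Qed.

Lemma measurable_row_affine (d : nat) (a : R) (b : 'rV[R]_d) :
  measurable_fun [set: 'rV[R]_d] (fun x => a *: x + b).
Proof.
apply: measurable_fun_rowP => i.
under eq_fun do rewrite !mxE.
apply: measurable_funD => //; apply: measurable_funM => //.
exact: (@measurable_coord _ R).
Qed.

(** Induction on [d]: the map acts separately on the first coordinate and on the rest, so uniqueness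
    of the product measure reduces the claim to rectangles. *)
Lemma lebesgue_row_affine (d : nat) (a : R) (b : 'rV[R]_d) : 0 < a ->
  forall A : set 'rV[R]_d, measurable A ->
  ((a ^+ d)%:E * lebesgue_row R d ((fun x => a *: x + b)%R @^-1` A))%E =
  lebesgue_row R d A.
Proof.
move=> a0; elim: d b => [|d IH] b A mA.
  rewrite expr0 mul1e /= !diracE; congr (_%:R%:E).
  have ab : a *: 0 + b = 0 by apply/rowP => -[].
  congr nat_of_bool; by apply/idP/idP; rewrite !inE/= ab.
pose b' := uncons_row b.
pose f1 : measurableTypeR R -> measurableTypeR R := fun x => a * x + b'.1.
pose f2 := fun x : 'rV[R]_d => a *: x + b'.2.
have mf1 : measurable_fun setT f1 by exact: measurable_fun_affine.
have mf2 : measurable_fun setT f2 by exact: measurable_row_affine.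
pose f := fun p : measurableTypeR R * 'rV[R]_d => (f1 p.1, f2 p.2).
have mf : measurable_fun setT f.
  by apply/measurable_fun_pair; apply: measurableT_comp.
pose a' : {nonneg R} := NngNum (exprn_ge0 d.+1 (ltW a0)).
pose m :=
  mscale a' (pushforward (@lebesgue_measure R \x lebesgue_row R d)%E
    f : {measure set _ -> \bar R}).
have mc := @measurable_cons_row R d.
have -> : lebesgue_row R d.+1 A = 
   (@lebesgue_measure R \x lebesgue_row R d)%E (@cons_row R d @^-1` A) by [].
have mA' : measurable (@cons_row R d @^-1` A).
  by rewrite -[X in measurable X]setTI; exact: mc.
rewrite (product_measure_unique (m' := m mf))//.
  rewrite /m/= /mscale /pushforward/=; congr (_ * _)%E.
  rewrite /cons_measure /pushforward; congr (_ _).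
  apply/seteqP; split => -[x y] /=.
    rewrite [X in A X](_ : _ = cons_row (f (x, y)))//; apply/rowP => i.
    rewrite !mxE/=; case: unliftP => [j ->|->]; rewrite /f/=.
      by rewrite !mxE.
    by [].
  rewrite [X in A X -> _](_ : _ = a *: cons_row (x, y) + b)//; apply/rowP => i.
  rewrite !mxE/=; case: unliftP => [j ->|->]; rewrite /f/=.
    by rewrite !mxE.
  by [].
move=> B C mB mC; rewrite /m/= /mscale/= /pushforward/=.
rewrite [X in product_measure1 _ _ X](_ : _ = (f1 @^-1` B) `*` (f2 @^-1` C))//.
rewrite product_measure1E//=; last 2 first.
- by rewrite -[X in measurable X]setTI; exact: mf1.
- by rewrite -[X in measurable X]setTI; exact: mf2.
rewrite exprS EFinM muleACA.
by rewrite -(lebesgue_measure_affine b'.1 a0 mB) -(IH b'.2 C mC).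
Qed.

Lemma ge0_integral_row_affine (d : nat) (a : R) (b : 'rV[R]_d)
    (f : 'rV[R]_d -> \bar R) : 0 < a -> measurable_fun setT f ->
  (forall x, 0 <= f x)%E ->
  ((a ^+ d)%:E * \int[lebesgue_row R d]_x f (a *: x + b)%R =
   \int[lebesgue_row R d]_x f x)%E.
Proof.
move=> a0 mf f0.
pose phi := fun x : 'rV[R]_d => a *: x + b.
have mphi : measurable_fun setT phi by exact: measurable_row_affine.
pose a' : {nonneg R} := NngNum (exprn_ge0 d (ltW a0)).
pose m := mscale a'
  (pushforward (lebesgue_row R d) phi : {measure set _ -> \bar R}).
transitivity (\int[m mphi]_x f x)%E; last first.
  by apply: eq_measure_integral => A mA _; exact: lebesgue_row_affine.
rewrite ge0_integral_mscale//; congr (_ * _)%E.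
by rewrite ge0_integral_pushforward.
Qed.

Lemma integrable_row_affine (d : nat) (a : R) (b : 'rV[R]_d)
    (f : 'rV[R]_d -> R) : 0 < a ->
  (lebesgue_row R d).-integrable setT (EFin \o f) ->
  (lebesgue_row R d).-integrable setT (EFin \o (fun x => f (a *: x + b))).
Proof.
move=> a0 /integrableP[mf foo]; apply/integrableP; split.
  apply: (@measurableT_comp _ _ _ _ _ _ (EFin \o f)) => //.
  exact: measurable_row_affine.
move: foo; rewrite -(@ge0_integral_row_affine d a b)//; last first.
  exact: measurableT_comp.
rewrite [X in (_ * X)%E](_ : _ = \int[lebesgue_row R d]_x `|(f (a *: x + b))%:E|)%E//.
rewrite !ltey; apply: contra => /eqP ->.
by rewrite mulr_infty gtr0_sg ?exprn_gt0// mul1e.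
Qed.

Lemma Rintegral_row_affine (d : nat) (a : R) (b : 'rV[R]_d)
    (f : 'rV[R]_d -> R) : 0 < a ->
  (lebesgue_row R d).-integrable setT (EFin \o f) ->
  a ^+ d * \int[lebesgue_row R d]_x f (a *: x + b) =
  \int[lebesgue_row R d]_x f x.
Proof.
move=> a0 if_; have if' := integrable_row_affine b a0 if_.
have mf := measurable_int _ if_.
have fE : EFin \o (fun x => f (a *: x + b)) =
    (EFin \o f) \o (fun x => a *: x + b) by [].
pose mu := lebesgue_row R d.
have -> : \int[mu]_x f x =
    fine ((a ^+ d)%:E * \int[mu]_x (f (a *: x + b))%:E)%E.
  rewrite /Rintegral (integralE _ _ (fun x => (f x)%:E)).
  rewrite -(@ge0_integral_row_affine d a b (EFin \o f)^\+%E)//; last first.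
    exact: measurable_funepos.
  rewrite -(@ge0_integral_row_affine d a b (EFin \o f)^\-%E)//; last first.
    exact: measurable_funeneg.
  rewrite -muleBr//; last first.
    by have := integrable_add_def measurableT if'; rewrite fE funepos_comp funeneg_comp.
  congr (fine (_ * _)%E).
  rewrite [RHS](integralE _ _ ((EFin \o f) \o (fun x => a *: x + b))).
  by rewrite !(funepos_comp _ (fun x => a *: x + b)) !(funeneg_comp _ (fun x => a *: x + b)).
by rewrite fineM ?(integrable_fin_num measurableT if').
Qed.
End affine_invariance.

(** * Real square-integrable functions, and Bessel bounds from Gram matrices *)

Section square_integrable.
Context (disp : measure_display) (T : measurableType disp) (R : realType).
Variable mu : {measure set T -> \bar R}.
Implicit Types f g : T -> R.

Local Notation L1 f := (mu.-integrable setT (EFin \o f)).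

(** Measurability is a separate clause because that of [f ^+ 2] does not imply that of [f]. *)
Definition square_integrable f :=
  measurable_fun setT f /\ L1 (fun x => f x ^+ 2).

Lemma le_integrable_EFin f g : measurable_fun setT f ->
  (forall x, `|f x| <= `|g x|) -> L1 g -> L1 f.
Proof.
move=> mf fg; apply: le_integrable => //; first exact/measurable_EFinP.
by move=> x _; rewrite lee_fin.
Qed.

Lemma integrableZ_EFin c f : L1 f -> L1 (fun x => c * f x).
Proof. exact: integrableZl. Qed.

Lemma integrableD_EFin f g : L1 f -> L1 g -> L1 (fun x => f x + g x).
Proof. exact: integrableD. Qed.

Lemma integrableB_EFin f g : L1 f -> L1 g -> L1 (fun x => f x - g x).
Proof. exact: integrableB. Qed.

Lemma integrable_sum_EFin (I : Type) (s : seq I) (F : I -> T -> R) :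
  (forall i, L1 (F i)) -> L1 (fun x => \sum_(i <- s) F i x).
Proof.
move=> iF; elim: s => [|i s IH].
  by under eq_fun do rewrite big_nil; exact: integrable0.
by under eq_fun do rewrite big_cons; exact: integrableD_EFin.
Qed.

Lemma Rintegral_sum (I : Type) (s : seq I) (F : I -> T -> R) :
  (forall i, L1 (F i)) ->
  \int[mu]_x (\sum_(i <- s) F i x) = \sum_(i <- s) \int[mu]_x F i x.
Proof.
move=> iF; elim: s => [|i s IH].
  rewrite big_nil; under eq_Rintegral do rewrite big_nil.
  by rewrite Rintegral_cst// mul0r.
rewrite big_cons -IH; under eq_Rintegral do rewrite big_cons.
by rewrite RintegralD//; exact: integrable_sum_EFin.
Qed.

Lemma measurable_EFin_integrable f : L1 f -> measurable_fun setT f.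
Proof. by move=> /measurable_int /measurable_EFinP. Qed.

Lemma square_integrableM f g : square_integrable f -> square_integrable g ->
  L1 (fun x => f x * g x).
Proof.
move=> [mf f2] [mg g2].
apply: (@le_integrable_EFin _ (fun x => f x ^+ 2 + g x ^+ 2)).
- exact: measurable_funM.
- move=> x; rewrite [leRHS]ger0_norm ?addr_ge0 ?sqr_ge0//.
  rewrite normrM -(real_normK (num_real (f x))) -(real_normK (num_real (g x))).
  by have := normr_ge0 (f x); have := normr_ge0 (g x); nra.
- exact: integrableD_EFin.
Qed.

Lemma le_square_integrable f g : measurable_fun setT f ->
  (forall x, `|f x| <= `|g x|) -> square_integrable g -> square_integrable f.
Proof.
move=> mf fg [mg g2]; split => //; apply: le_integrable_EFin g2.
  exact: measurable_funX.
by move=> x; rewrite !normrX; apply: lerXn2r; rewrite ?nnegrE.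
Qed.

Lemma square_integrableD f g : square_integrable f -> square_integrable g ->
  square_integrable (fun x => f x + g x).
Proof.
move=> [mf f2] [mg g2]; split; first exact: measurable_funD.
apply: (@le_integrable_EFin _ (fun x => 2 * (f x ^+ 2 + g x ^+ 2))).
- by apply: measurable_funX; exact: measurable_funD.
- move=> x; rewrite (ger0_norm (sqr_ge0 _)) ger0_norm.
    by have := sqr_ge0 (f x - g x); nra.
  by rewrite mulr_ge0// addr_ge0 ?sqr_ge0.
- by apply: integrableZ_EFin; exact: integrableD_EFin.
Qed.

Lemma square_integrableZ c f : square_integrable f ->
  square_integrable (fun x => c * f x).
Proof.
move=> [mf f2]; split; first exact: measurable_funM.
by under eq_fun do rewrite exprMn; exact: integrableZ_EFin.
Qed.

Lemma square_integrableB f g : square_integrable f -> square_integrable g ->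
  square_integrable (fun x => f x - g x).
Proof.
move=> f2 /(square_integrableZ (-1)) g2.
by have := square_integrableD f2 g2; under eq_fun do rewrite mulN1r.
Qed.

Lemma square_integrable_sum (I : Type) (s : seq I) (F : I -> T -> R) :
  (forall i, square_integrable (F i)) ->
  square_integrable (fun x => \sum_(i <- s) F i x).
Proof.
move=> F2; elim: s => [|i s IH].
  under eq_fun do rewrite big_nil; split; first exact: measurable_cst.
  under eq_fun do rewrite expr0n/=; exact: integrable0.
by under eq_fun do rewrite big_cons; exact: square_integrableD.
Qed.

(* Expand [0 <= \int (f - B^-1 * \sum_i <f, u_i> u_i) ^+ 2]. *)
Lemma bessel_le_of_gram (I : Type) (s : seq I) (u : I -> T -> R) (B : R) :
  0 < B -> (forall i, square_integrable (u i)) ->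
  (forall a : I -> R,
    \sum_(i <- s) \sum_(j <- s) a i * a j * \int[mu]_x (u i x * u j x) <=
    B * \sum_(i <- s) a i ^+ 2) ->
  forall f, square_integrable f ->
  \sum_(i <- s) (\int[mu]_x (f x * u i x)) ^+ 2 <= B * \int[mu]_x f x ^+ 2.
Proof.
move=> B0 u2 gram f f2.
pose a i := \int[mu]_x (f x * u i x).
pose U x := \sum_(i <- s) a i * u i x.
have U2 : square_integrable U.
  by apply: square_integrable_sum => i; exact: square_integrableZ.
have fU : \int[mu]_x (f x * U x) = \sum_(i <- s) a i ^+ 2.
  under eq_Rintegral do rewrite mulr_sumr.
  rewrite Rintegral_sum; last first.
    by move=> i; apply: square_integrableM => //; exact: square_integrableZ.
  apply: eq_bigr => i _; under eq_Rintegral do rewrite mulrCA.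
  by rewrite RintegralZl//; exact: square_integrableM.
have UU : \int[mu]_x (U x ^+ 2) =
    \sum_(i <- s) \sum_(j <- s) a i * a j * \int[mu]_x (u i x * u j x).
  under eq_Rintegral do rewrite expr2 {1}/U mulr_suml.
  have uU i : square_integrable (fun x => a i * u i x) by exact: square_integrableZ.
  rewrite Rintegral_sum; last by move=> i; exact: square_integrableM.
  apply: eq_bigr => i _; under eq_Rintegral do rewrite mulr_sumr.
  rewrite Rintegral_sum; last by move=> j; exact: square_integrableM.
  apply: eq_bigr => j _; under eq_Rintegral do rewrite mulrACA.
  by rewrite RintegralZl//; exact: square_integrableM.
have : 0 <= \int[mu]_x (f x - B^-1 * U x) ^+ 2.
  by apply: Rintegral_ge0 => x _; exact: sqr_ge0.
have -> : \int[mu]_x (f x - B^-1 * U x) ^+ 2 =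
    \int[mu]_x (f x ^+ 2) - 2 * B^-1 * \int[mu]_x (f x * U x)
    + B^-1 ^+ 2 * \int[mu]_x (U x ^+ 2).
  rewrite -!RintegralZl//; [|by case: U2|exact: square_integrableM].
  rewrite -RintegralB//; [|by case: f2|]; last first.
    by apply: integrableZ_EFin; exact: square_integrableM.
  rewrite -RintegralD//; last 2 first.
  - apply: integrableB_EFin; first by case: f2.
    by apply: integrableZ_EFin; exact: square_integrableM.
  - by apply: integrableZ_EFin; case: U2.
  by apply: eq_Rintegral => x _; ring.
rewrite fU UU => H.
have {}H := le_trans H (lerD (lexx _) (ler_wpM2l (sqr_ge0 B^-1) (gram a))).
set S := \sum_(i <- s) a i ^+ 2 in H *.
rewrite -ler_pdivrMl// -subr_ge0.
apply: le_trans H _; rewrite le_eqVlt; apply/orP; left; apply/eqP.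
by field; rewrite gt_eqF.
Qed.

End square_integrable.

(** * The weighted Schur test and geometric sums over scales *)

Section schur_test.
Variable R : realFieldType.

(** Uses 2 |a_i a_j| <= a_i^2 w_j / w_i + a_j^2 w_i / w_j. By symmetry of [G] both terms give the
    same double sum, and that sum is controlled by the weighted row sums. *)
Lemma schur_test (I : eqType) (s : seq I) (G : I -> I -> R) (w : I -> R) (B : R) :
  (forall i, 0 < w i) -> (forall i j, G i j = G j i) ->
  (forall i, i \in s -> \sum_(j <- s) `|G i j| * w j <= B * w i) ->
  forall a : I -> R,
    \sum_(i <- s) \sum_(j <- s) a i * a j * G i j <= B * \sum_(i <- s) a i ^+ 2.
Proof.
move=> w0 Gsym Grow a.
pose H i j := a i ^+ 2 * (w i)^-1 * (`|G i j| * w j).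
have HB : \sum_(i <- s) \sum_(j <- s) H i j <= B * \sum_(i <- s) a i ^+ 2.
  rewrite mulr_sumr big_seq [leRHS]big_seq; apply: ler_sum => i si.
  rewrite /H -mulr_sumr -mulrA [leRHS]mulrC ler_wpM2l ?sqr_ge0//.
  by rewrite ler_pdivrMl// mulrC Grow.
have HT : \sum_(i <- s) \sum_(j <- s) H j i = \sum_(i <- s) \sum_(j <- s) H i j.
  by rewrite exchange_big.
apply: le_trans HB; rewrite -(ler_pM2l (ltr0n R 2)) mulr_natl mulr2n.
rewrite [leRHS]mulr_natl mulr2n -[X in _ <= X + _]HT -!big_split/=.
apply: ler_sum => i _; rewrite -!big_split/=; apply: ler_sum => j _.
rewrite /H (Gsym j i).
have wi := w0 i; have wj := w0 j.
(* In the variables a_i / w_i the inequality becomes 2 |x y| <= x^2 + y^2. *)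
pose x := a i * (w i)^-1; pose y := a j * (w j)^-1.
have -> : a i = x * w i by rewrite /x mulfVK// gt_eqF.
have -> : a j = y * w j by rewrite /y mulfVK// gt_eqF.
have -> : (y * w j) ^+ 2 / w j * (`|G i j| * w i) +
   (x * w i) ^+ 2 / w i * (`|G i j| * w j) =
   `|G i j| * (w i * w j) * (x ^+ 2 + y ^+ 2).
  by field; rewrite !gt_eqF.
apply: (@le_trans _ _ (`|G i j| * (w i * w j) * `|2 * x * y|)).
  have -> : x * w i * (y * w j) * G i j + x * w i * (y * w j) * G i j =
    (G i j * (2 * x * y)) * (w i * w j) by ring.
  rewrite [leRHS]mulrAC ler_pM2r ?mulr_gt0// -normrM; exact: ler_norm.
apply: ler_wpM2l; first by rewrite mulr_ge0// mulr_ge0 ?ltW.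
by rewrite ler_norml; apply/andP; split; [have := sqr_ge0 (x + y)|have := sqr_ge0 (x - y)]; nra.
Qed.

Lemma ler_sum_uniq_subseq (I : eqType) (s t : seq I) (F : I -> R) :
  uniq s -> uniq t -> {subset s <= t} -> (forall i, 0 <= F i) ->
  \sum_(i <- s) F i <= \sum_(i <- t) F i.
Proof.
move=> us ut st F0; rewrite [leRHS](bigID (mem s))/=.
have -> : \sum_(i <- t | i \in s) F i = \sum_(i <- s) F i.
  rewrite -big_filter; apply/perm_big/uniq_perm => //; first exact: filter_uniq.
  move=> i; rewrite mem_filter; apply/andP/idP => [[]//|si].
  by split => //; exact: st.
by rewrite lerDl sumr_ge0.
Qed.

(** The exponents are an arbitrary finite set, since the scales met by a finite subfamily need not
    be consecutive; the sum is enlarged to an initial segment. *)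
Lemma sum_geometric_le (th : R) (s : seq nat) : 0 <= th < 1 -> uniq s ->
  \sum_(k <- s) th ^+ k <= (1 - th)^-1.
Proof.
move=> /andP[th0 th1] us; pose N := (\max_(k <- s) k).+1.
apply: (@le_trans _ _ (\sum_(k <- iota 0 N) th ^+ k)).
  apply: ler_sum_uniq_subseq => //; first exact: iota_uniq.
    by move=> k ks; rewrite mem_iota/= add0n ltnS; exact: leq_bigmax_seq.
  by move=> k; exact: exprn_ge0.
have th1' : 0 < 1 - th by rewrite subr_gt0.
rewrite -[iota 0 N]/(index_iota 0 N) big_mkord -[leRHS]mulr1 ler_pdivlMl//.
by rewrite -[1 - th]opprB mulNr -subrX1 opprB gerBl exprn_ge0.
Qed.

(** On each side of [n] the distance to [n] is injective, so two one-sided geometric sums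
    suffice. *)
Lemma sum_geometric_abs_le (th : R) (n : int) (s : seq int) :
  0 <= th < 1 -> uniq s ->
  \sum_(m <- s) th ^+ `|n - m|%N <= 2 / (1 - th).
Proof.
move=> th01 us; rewrite (bigID (fun m => n <= m))/= mulrC mulr_natr mulr2n.
apply: lerD; rewrite -big_filter.
- rewrite -(big_map (fun m => `|n - m|%N) xpredT (fun k => th ^+ k)).
  apply: sum_geometric_le => //; rewrite map_inj_in_uniq ?filter_uniq//.
  by move=> m1 m2; rewrite !mem_filter => /andP[? _] /andP[? _]; lia.
- rewrite -(big_map (fun m => `|n - m|%N) xpredT (fun k => th ^+ k)).
  apply: sum_geometric_le => //; rewrite map_inj_in_uniq ?filter_uniq//.
  by move=> m1 m2; rewrite !mem_filter => /andP[? _] /andP[? _]; lia.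
Qed.

(** Serves to group the cubes of a finite family by scale. *)
Lemma sum_fibers (I : eqType) (J : eqType) (s : seq I) (sc : I -> J) (F : I -> R) :
  \sum_(i <- s) F i = \sum_(m <- undup (map sc s)) \sum_(i <- s | sc i == m) F i.
Proof.
rewrite (exchange_big_dep xpredT)//= big_seq [RHS]big_seq.
apply: eq_bigr => i si; rewrite -big_filter.
rewrite (eq_filter (a2 := pred1 (sc i))); last by move=> m; rewrite /= eq_sym.
by rewrite filter_pred1_uniq ?undup_uniq ?mem_undup ?map_f// big_seq1.
Qed.
End schur_test.

(** * Half-open boxes and their indicator functions *)

Section row_box.
Variables (R : realType) (d : nat).
Implicit Types a b : 'rV[R]_d.
Local Notation mu := (lebesgue_row R d).

Definition row_box a b : set 'rV[R]_d :=
  [set x | forall i, a ord0 i <= x ord0 i < b ord0 i].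

Lemma measurable_row_box a b : measurable (row_box a b).
Proof.
rewrite (_ : row_box a b = \bigcap_(i in [set: 'I_d])
    ((fun x : 'rV[R]_d => x ord0 i) @^-1` `[a ord0 i, b ord0 i[)).
  apply: fin_bigcap_measurable => // i _.
  by rewrite -[X in measurable X]setTI; apply: (@measurable_coord _ R).
by apply/seteqP; split => x /= h i; [move=> _|];
  have := h i; rewrite /= in_itv/=; apply.
Qed.

Lemma measurable_row_shift a : measurable_fun setT (fun x : 'rV[R]_d => x + a).
Proof.
rewrite (_ : (fun x => _) = (fun x : 'rV[R]_d => 1 *: x + a)).
  exact: measurable_row_affine.
by apply/funext => x; rewrite scale1r.
Qed.

Lemma lebesgue_row_row_box a b : (forall i, a ord0 i <= b ord0 i) ->
  mu (row_box a b) = (\prod_(i < d) (b ord0 i - a ord0 i))%:E.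
Proof. exact: lebesgue_row_box. Qed.

Lemma Rintegral_indic_row_box a b : (forall i, a ord0 i <= b ord0 i) ->
  \int[mu]_x \1_(row_box a b) x = \prod_(i < d) (b ord0 i - a ord0 i).
Proof.
move=> ab; rewrite /Rintegral integral_indic//; last exact: measurable_row_box.
by rewrite setIT; exact: congr1 (lebesgue_row_row_box ab).
Qed.

Lemma integrable_indic_row_box a b : (forall i, a ord0 i <= b ord0 i) ->
  mu.-integrable setT (EFin \o (\1_(row_box a b) : _ -> R)).
Proof.
move=> ab; have mB := measurable_row_box a b.
apply/integrableP; split; first exact/measurable_EFinP.
under eq_integral do rewrite /= ger0_norm//.
rewrite integral_indic// setIT.
exact: etrans (congr1 (fun z => z < +oo)%E (lebesgue_row_row_box ab)) (ltry _).
Qed.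

Lemma square_integrable_indic_row_box a b : (forall i, a ord0 i <= b ord0 i) ->
  square_integrable mu (\1_(row_box a b) : _ -> R).
Proof.
move=> ab; split; first by apply: measurable_indic; exact: measurable_row_box.
rewrite (_ : (fun x => _) = (\1_(row_box a b) : _ -> R)).
  exact: integrable_indic_row_box.
by apply/funext => x; rewrite indicE; case: (_ \in _); rewrite ?expr1n ?expr0n.
Qed.

End row_box.

(** * Haar functions on the unit cube and their L^1 modulus of continuity *)

Section haar_products.
Variables (R : realType) (d : nat).
Implicit Types (g : R -> R) (P : 'rV[R]_d -> R).
Local Notation mu := (lebesgue_row R d).

Lemma chi01E (t : R) : chi01 t = (0 <= t < 1)%R%:R.
Proof. by rewrite /chi01 indicE mem_setE in_itv. Qed.

Lemma haar01E (t : R) : haar01 t = (0 <= t < 2^-1)%R%:R - (2^-1 <= t < 1)%R%:R.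
Proof. by rewrite /haar01 !indicE !mem_setE !in_itv. Qed.

Lemma measurable_haar01 : measurable_fun setT (@haar01 R).
Proof. by apply: measurable_funB; apply: measurable_indic. Qed.

Lemma haar01_values g (t : R) : g = @haar01 R \/ g = @chi01 R ->
  [\/ g t = -1, g t = 0 | g t = 1].
Proof.
case=> ->; last by rewrite chi01E; case: (_ && _); [constructor 3|constructor 2].
rewrite haar01E; case: (ltP t 2^-1) => ?; case: (_ <= _); case: (_ < _) => /=;
  rewrite ?subr0 ?sub0r; by [constructor 1|constructor 2|constructor 3].
Qed.

Lemma haar01_supp g (t : R) : g = @haar01 R \/ g = @chi01 R -> g t != 0 -> 0 <= t < 1.
Proof.
case=> ->; last by rewrite chi01E; case: (_ && _); rewrite ?eqxx.
rewrite haar01E; have [?|H] := boolP (0 <= t < 2^-1); first lra.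
have [?|H'] := boolP (2^-1 <= t < 1); first lra.
by rewrite subrr eqxx.
Qed.

Lemma haar01_jump g (t s rho : R) : g = @haar01 R \/ g = @chi01 R -> 0 < rho ->
  `|s| <= rho -> g t != g (t - s) ->
  exists2 p, p \in [:: 0; 2^-1; 1] & p - rho <= t < p + 2 * rho.
Proof.
move=> gE rho0; rewrite ler_norml => /andP[s1 s2] tts.
have [/andP[??]|H0] := boolP (0 - rho <= t < 0 + 2 * rho).
  by exists 0; [rewrite !inE eqxx|lra].
have [/andP[??]|H1] := boolP (2^-1 - rho <= t < 2^-1 + 2 * rho).
  by exists 2^-1; [rewrite !inE eqxx orbT|lra].
have [/andP[??]|H2] := boolP (1 - rho <= t < 1 + 2 * rho).
  by exists 1; [rewrite !inE eqxx !orbT|lra].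
exfalso; move/eqP : tts; apply.
have E0 : (0 <= t) = (0 <= t - s) by lra.
have E1 : (t < 2^-1) = (t - s < 2^-1) by lra.
have E1' : (2^-1 <= t) = (2^-1 <= t - s) by lra.
have E2 : (t < 1) = (t - s < 1) by lra.
by case: gE => ->; rewrite ?chi01E ?haar01E E0 E2 // E1 E1'.
Qed.

Lemma measurable_haar_products P : haar_products P -> measurable_fun setT P.
Proof.
move=> [g [gE _ ->]]; apply: measurable_prod => i _.
apply: (measurableT_comp (f := g i)); last exact: (@measurable_coord _ R).
by case: (gE i) => ->; [exact: measurable_haar01|exact: measurable_indic].
Qed.

Lemma haar_products_values P x : haar_products P ->
  [\/ P x = -1, P x = 0 | P x = 1].
Proof.
move=> [g [gE _ ->]]; elim/big_rec : _ => [|i y _ IH]; first by constructor 3.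
case: (haar01_values (x ord0 i) (gE i)) => ->; case: IH => ->;
  rewrite ?mul0r ?mulr0 ?mul1r ?mulr1 ?mulrNN ?mulr1;
  by [constructor 1|constructor 2|constructor 3].
Qed.

Lemma haar_products_supp P x : haar_products P -> P x != 0 ->
  forall i, 0 <= x ord0 i < 1.
Proof.
move=> [g [gE _ ->]] + i => /prodf_neq0/(_ i isT)/=.
exact: haar01_supp.
Qed.

Lemma haar_products_norm_le1 P x : haar_products P -> `|P x| <= 1.
Proof.
by move=> /(haar_products_values x)[] ->; rewrite ?normrN ?normr0 ?normr1.
Qed.

(* [P] and its translate can only differ within [rho] of one of the [3 * d]
   hyperplanes [x_i = 0, 1/2, 1], and there they differ by at most [2]. *)
Lemma haar_products_modulus P (s : 'rV[R]_d) (rho : R) : haar_products P ->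
  0 < rho <= 1 -> (forall i, `|s ord0 i| <= rho) ->
  \int[mu]_x `|P x - P (x - s)| <= 6 * d%:R * 3 ^+ d * rho.
Proof.
move=> hP /andP[rho0 rho1] srho.
pose ps : seq R := [:: 0; 2^-1; 1].
pose a (i : 'I_d) (p : R) : 'rV[R]_d := \row_j (if j == i then p - rho else -1).
pose b (i : 'I_d) (p : R) : 'rV[R]_d := \row_j (if j == i then p + 2 * rho else 2).
have ab i p j : a i p ord0 j <= b i p ord0 j.
  by rewrite !mxE; case: ifP => _; lra.
pose N x : R := \sum_(i < d) \sum_(p <- ps) \1_(row_box (a i p) (b i p)) x.
have PN x : `|P x - P (x - s)| <= 2 * N x.
  have N0 : 0 <= N x by apply: sumr_ge0 => i _; exact: sumr_ge0.
  have [->|neP] := eqVneq (P x) (P (x - s)).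
    by rewrite subrr normr0 mulr_ge0.
  apply: (@le_trans _ _ 2).
    apply: (le_trans (ler_normB _ _)).
    by have := haar_products_norm_le1 x hP; have := haar_products_norm_le1 (x - s) hP; lra.
  rewrite ler_pMr//.
  (* One of [x] and [x - s] lies in the unit cube, and [rho <= 1]. *)
  have box j : -1 <= x ord0 j < 2.
    have [Px|Px] := eqVneq (P x) 0.
      have Pxs : P (x - s) != 0 by rewrite -Px eq_sym.
      have := haar_products_supp hP Pxs j; rewrite !mxE.
      by have := srho j; rewrite ler_norml; lra.
    by have := haar_products_supp hP Px j; lra.
  have [g [gE _ PE]] := hP.
  have [i gi] : exists i, g i (x ord0 i) != g i (x ord0 i - s ord0 i).
    apply: contrapT => /forallNP H; move/eqP : neP; apply.
    rewrite PE; apply: eq_bigr => i _; rewrite !mxE.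
    by have /negP := H i; rewrite negbK => /eqP.
  have [p pps xp] := haar01_jump (gE i) rho0 (srho i) gi.
  have xB : row_box (a i p) (b i p) x.
    by move=> j; rewrite !mxE; case: eqVneq => [->|_].
  apply: (@le_trans _ _ (\1_(row_box (a i p) (b i p)) x)).
    by rewrite indicE mem_set.
  rewrite /N (bigD1 i)//= (bigD1_seq p)//=; last first.
    rewrite !inE; apply/andP; split; first by lra.
    by rewrite andbT; lra.
  rewrite -addrA lerDl addr_ge0//; first exact: sumr_ge0.
  by apply: sumr_ge0 => ? _; exact: sumr_ge0.
have iB i p : mu.-integrable setT (EFin \o (\1_(row_box (a i p) (b i p)) : _ -> R)).
  exact: integrable_indic_row_box.
have iN : mu.-integrable setT (EFin \o N).
  by apply: integrable_sum_EFin => i; exact: integrable_sum_EFin.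
have mP := measurable_haar_products hP.
have mPs : measurable_fun setT (fun x : 'rV[R]_d => P (x - s)).
  by apply: measurableT_comp => //; exact: measurable_row_shift.
have mPP : measurable_fun setT (fun x : 'rV[R]_d => `|P x - P (x - s)|).
  by apply: measurableT_comp => //; exact: measurable_funB.
apply: (@le_trans _ _ (\int[mu]_x (2 * N x))).
  apply: le_Rintegral => //; last exact: integrableZ_EFin.
  apply: le_integrable_EFin (integrableZ_EFin 2 iN) => // x.
  by rewrite normr_id (le_trans (PN x))// ler_norm.
rewrite RintegralZl// Rintegral_sum; last first.
  by move=> i; exact: integrable_sum_EFin.
(* The constant [6 * d * 3 ^ d]: the jump size [2], the three jumps and the [d] coordinates, times
   the volume of one box. *)
rewrite (eq_bigr (fun=> 3 * (3 ^+ d * rho))); last first.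
  move=> i _; rewrite Rintegral_sum//.
  rewrite (eq_bigr (fun=> 3 ^+ d * rho)); last first.
    move=> p _; rewrite Rintegral_indic_row_box//.
    rewrite (bigD1 i)//= !mxE eqxx.
    rewrite (eq_bigr (fun=> 3)); last first.
      by move=> j /negbTE ji; rewrite !mxE ji; ring.
    rewrite prodr_const cardC1 card_ord.
    by case: {a b ab iB iN N PN} d i => [[]//|n _]; rewrite exprS/=; ring.
  by rewrite big_const_seq/= addr0; ring.
by rewrite sumr_const card_ord -mulr_natl le_eqVlt; apply/orP; left; apply/eqP; ring.
Qed.

End haar_products.

(** * Translation invariance, and summation under the integral *)

Section translations.
Variables (R : realType) (d : nat).
Local Notation mu := (lebesgue_row R d).
Implicit Types (f : 'rV[R]_d -> R) (a : 'rV[R]_d).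

Lemma integrable_shift f a : mu.-integrable setT (EFin \o f) ->
  mu.-integrable setT (EFin \o (fun x => f (x + a))).
Proof.
move=> /(integrable_row_affine a (@ltr01 R)).
by under [X in mu.-integrable _ (EFin \o X) -> _]eq_fun do rewrite scale1r.
Qed.

Lemma Rintegral_shift f a : mu.-integrable setT (EFin \o f) ->
  \int[mu]_x f (x + a) = \int[mu]_x f x.
Proof.
move=> /(Rintegral_row_affine a (@ltr01 R)) <-.
by rewrite expr1n mul1r; under [RHS]eq_Rintegral do rewrite scale1r.
Qed.

Lemma square_integrable_shift f a : square_integrable mu f ->
  square_integrable mu (fun x => f (x + a)).
Proof.
move=> [mf f2]; split; last exact: (integrable_shift a f2).
by apply: measurableT_comp => //; exact: measurable_row_shift.
Qed.

End translations.

(** Summing under the integral makes the bound independent of the number of functions: for the Haar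
    functions of one scale, [M] reflects that their cubes are disjoint. *)
Lemma sum_abs_Rintegral_le (disp : measure_display) (T : measurableType disp)
    (R : realType) (mu : {measure set T -> \bar R}) (I : Type) (s : seq I)
    (G : T -> R) (u : I -> T -> R) (M : R) :
  mu.-integrable setT (EFin \o G) ->
  (forall i, mu.-integrable setT (EFin \o (fun x => G x * u i x))) ->
  (forall x, \sum_(i <- s) `|u i x| <= M) ->
  \sum_(i <- s) `|\int[mu]_x (G x * u i x)| <= M * \int[mu]_x `|G x|.
Proof.
move=> iG iGu uM.
apply: (@le_trans _ _ (\sum_(i <- s) \int[mu]_x `|G x * u i x|)).
  by apply: ler_sum => i _; exact: le_normr_Rintegral.
rewrite -Rintegral_sum; last by move=> i; exact: integrable_norm.
rewrite -RintegralZl//; last exact: integrable_norm.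
apply: le_Rintegral => //.
- by apply: integrable_sum_EFin => i; exact: integrable_norm.
- by apply: integrableZ_EFin; exact: integrable_norm.
- move=> x _; under eq_bigr do rewrite normrM.
  by rewrite -mulr_sumr mulrC ler_wpM2r.
Qed.

(** * Haar functions on arbitrary dyadic cubes *)

Section haar_on_cubes.
Variables (R : realType) (d : nat).
Local Notation mu := (lebesgue_row R d).
Local Notation r := (Num.sqrt (2 : R)).

Lemma side_gt0 (Q : dyadic d) : 0 < side R Q.
Proof. by rewrite exprz_gt0. Qed.

(** Side lengths, normalizations and weights are all written as integer powers of the square root of
    2, so that the final estimate is an identity between integer exponents. *)
Lemma sideE (Q : dyadic d) : side R Q = r ^ (2 * Q.1).
Proof. by rewrite /side -exprz_exp -exprnP sqr_sqrtr. Qed.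

Lemma L2_scaleE (Q : dyadic d) : L2_scale R Q = r ^ (- (Q.1 * d%:Z)).
Proof.
rewrite /L2_scale mulrC powRrM powR12_sqrt// -[X in _ * X]/(d%:Z%:~R) -intrM.
by rewrite -intrN powR_intmul.
Qed.

Lemma L2_scale_gt0 (Q : dyadic d) : 0 < L2_scale R Q.
Proof. by rewrite powR_gt0. Qed.

Lemma to_unitE (Q : dyadic d) x :
  to_unit Q x = 2 ^ (- Q.1) *: x + (- \row_i (Q.2 ord0 i)%:~R) :> 'rV[R]_d.
Proof. by apply/rowP => i; rewrite !mxE. Qed.

Lemma to_unit_cube (Q : dyadic d) (x : 'rV[R]_d) :
  (forall i, 0 <= to_unit Q x ord0 i < 1) <-> cube Q x.
Proof.
have s0 := side_gt0 Q.
suff E i : (0 <= to_unit Q x ord0 i < 1) = 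
    ((Q.2 ord0 i)%:~R * side R Q <= x ord0 i < ((Q.2 ord0 i)%:~R + 1) * side R Q).
  by split => + i => /(_ i); rewrite E.
rewrite mxE -invr_expz -/(side R Q) subr_ge0 ltrBlDr mulrC.
by rewrite ler_pdivlMr// ltr_pdivrMr// [1 + _]addrC.
Qed.

Lemma cubeE (Q : dyadic d) : cube Q =
  row_box (\row_i ((Q.2 ord0 i)%:~R * side R Q))
          (\row_i (((Q.2 ord0 i)%:~R + 1) * side R Q)).
Proof.
by apply/seteqP; split => x /= + i => /(_ i); rewrite !mxE.
Qed.

Variable h0 : 'I_(2 ^ d).-1 -> 'rV[R]_d -> R.
Hypothesis h0P : forall k, haar_products (h0 k).
Local Notation h := (haar h0).
Implicit Types (Q : dyadic d) (k : 'I_(2 ^ d).-1).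

Lemma haar_supp Q k x : h Q k x != 0 -> cube Q x.
Proof.
rewrite mulf_eq0 negb_or => /andP[_ /(haar_products_supp (h0P k))].
exact: (to_unit_cube Q x).1.
Qed.

Lemma haar_norm_le Q k x : `|h Q k x| <= L2_scale R Q * \1_(cube Q) x.
Proof.
have [->|/haar_supp Qx] := eqVneq (h Q k x) 0.
  by rewrite normr0 mulr_ge0// ltW// L2_scale_gt0.
rewrite indicE mem_set// mulr1 normrM gtr0_norm ?L2_scale_gt0//.
by rewrite ler_piMr ?(ltW (L2_scale_gt0 Q))// haar_products_norm_le1.
Qed.

Lemma haar_values Q k x :
  [\/ h Q k x = - L2_scale R Q, h Q k x = 0 | h Q k x = L2_scale R Q].
Proof.
rewrite /haar; have [->|->|->] := haar_products_values (to_unit Q x) (h0P k).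
- by constructor 1; rewrite mulrN1.
- by constructor 2; rewrite mulr0.
- by constructor 3; rewrite mulr1.
Qed.

Lemma measurable_haar Q k : measurable_fun setT (h Q k).
Proof.
apply: measurable_funM => //; rewrite (funext (to_unitE Q)).
apply: measurableT_comp; last exact: measurable_row_affine.
exact: measurable_haar_products.
Qed.

Lemma cube_side_le Q i :
  (\row_i ((Q.2 ord0 i)%:~R * side R Q)) ord0 i <=
  (\row_i (((Q.2 ord0 i)%:~R + 1) * side R Q)) ord0 i.
Proof. by rewrite !mxE ler_pM2r ?side_gt0// lerDl. Qed.

Lemma integrable_haar Q k : mu.-integrable setT (EFin \o h Q k).
Proof.
apply: (@le_integrable_EFin _ _ _ _ _ (fun x => L2_scale R Q * \1_(cube Q) x)).
- exact: measurable_haar.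
- by move=> x; rewrite (le_trans (haar_norm_le _ _ _))// ler_norm.
- apply: integrableZ_EFin; rewrite cubeE; apply: integrable_indic_row_box.
  exact: cube_side_le.
Qed.

Lemma square_integrable_haar Q k : square_integrable mu (h Q k).
Proof.
apply: (@le_square_integrable _ _ _ _ _ (fun x => L2_scale R Q * \1_(cube Q) x)).
- exact: measurable_haar.
- by move=> x; rewrite (le_trans (haar_norm_le _ _ _))// ler_norm.
- apply: square_integrableZ; rewrite cubeE; apply: square_integrable_indic_row_box.
  exact: cube_side_le.
Qed.

Lemma haar_unit_dyadic k : h (unit_dyadic d) k = h0 k.
Proof.
apply/funext => x; rewrite /haar /L2_scale /= mul0r oppr0 mul0r powRr0 mul1r.
by congr (h0 k _); apply/rowP => i; rewrite !mxE/= oppr0 expr0z mul1r subr0.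
Qed.

(** The estimate on the unit cube for the shift s / l(Q), times the Jacobian l(Q)^d and the
    normalization of [h]. *)
Lemma haar_modulus Q k (s : 'rV[R]_d) (rho : R) : 0 < rho <= side R Q ->
  (forall i, `|s ord0 i| <= rho) ->
  \int[mu]_x `|h Q k x - h Q k (x - s)| <=
  6 * d%:R * 3 ^+ d * L2_scale R Q * side R Q ^+ d * (rho / side R Q).
Proof.
move=> /andP[rho0 rhoQ] srho; have S0 := side_gt0 Q; have L0 := L2_scale_gt0 Q.
have a0 : 0 < 2 ^ (- Q.1) :> R by rewrite exprz_gt0.
pose b : 'rV[R]_d := - \row_i (Q.2 ord0 i)%:~R.
pose F z := `|h0 k z - h0 k (z - 2 ^ (- Q.1) *: s)|.
have ih0 : mu.-integrable setT (EFin \o h0 k).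
  by rewrite -haar_unit_dyadic; exact: integrable_haar.
have iF : mu.-integrable setT (EFin \o F).
  apply: integrable_norm; apply: integrableB_EFin => //.
  exact: integrable_shift.
have FE x : `|h Q k x - h Q k (x - s)| = L2_scale R Q * F (2 ^ (- Q.1) *: x + b).
  rewrite /haar -mulrBr normrM gtr0_norm// !to_unitE; congr (_ * `|_ - h0 k _|).
  by rewrite scalerBr addrAC.
under eq_Rintegral do rewrite FE.
rewrite RintegralZl//; last exact: integrable_row_affine.
have : \int[mu]_x F x <= 6 * d%:R * 3 ^+ d * (rho / side R Q).
  apply: haar_products_modulus => //.
    by rewrite divr_gt0//= ler_pdivrMr// mul1r.
  move=> i; rewrite mxE -invr_expz -/(side R Q) normrM gtr0_norm ?invr_gt0//.
  by rewrite mulrC ler_pM2r ?invr_gt0.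
rewrite -(Rintegral_row_affine b a0 iF) -invr_expz -/(side R Q) exprVn.
rewrite ler_pdivrMl ?exprn_gt0// => /(ler_wpM2l (ltW L0)) /le_trans; apply.
by rewrite le_eqVlt; apply/orP; left; apply/eqP; ring.
Qed.

(** Only one cube of scale [n] contains [x], the one whose coordinates are the integer parts of
    2^(-n) x_i; it carries [(2 ^ d).-1] Haar functions. *)
Lemma sum_haar_le (n : int) (s : seq (dyadic d * 'I_(2 ^ d).-1)) x : uniq s ->
  \sum_(q <- s | q.1.1 == n) `|h q.1 q.2 x| <=
  (2 ^ d).-1%:R * r ^ (- (n * d%:Z)).
Proof.
move=> us; pose Qx : dyadic d := (n, \row_i Num.floor (2 ^ (- n) * x ord0 i)).
have QxP Q : Q.1 = n -> cube Q x -> Q = Qx.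
  case: Q => m j /= -> /to_unit_cube H; congr pair; apply/rowP => i.
  rewrite mxE; apply/esym/floor_def; have := H i.
  by rewrite !mxE/= intrD; lra.
rewrite -big_filter; set t := [seq q <- s | q.1.1 == n].
pose U : seq (dyadic d * 'I_(2 ^ d).-1) := [seq (Qx, k) | k <- enum 'I_(2 ^ d).-1].
have uU : uniq U by rewrite map_inj_uniq ?enum_uniq// => ? ? [].
apply: (@le_trans _ _ (\sum_(q <- U) `|h q.1 q.2 x|)).
  rewrite (bigID (fun q => q.1 == Qx))/= [X in _ + X]big1_seq ?addr0; last first.
    move=> q /andP[qx]; rewrite mem_filter => /andP[/eqP qn _].
    apply/eqP; rewrite normr_eq0; apply: contraNT qx => /haar_supp qx.
    by apply/eqP/QxP.
  rewrite -big_filter; apply: ler_sum_uniq_subseq => //.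
    by rewrite !filter_uniq.
  move=> [Q k]; rewrite mem_filter/= => /andP[/eqP -> _].
  by apply: map_f; rewrite mem_enum.
rewrite big_map (@le_trans _ _ (\sum_(k <- enum 'I_(2 ^ d).-1) L2_scale R Qx))//.
  apply: ler_sum => k _; apply: (le_trans (haar_norm_le _ _ _)).
  by rewrite ler_piMr ?(ltW (L2_scale_gt0 _))// indicE lern1 leq_b1.
by rewrite big_const_seq count_predT size_enum_ord iter_addr_0 L2_scaleE mulr_natl.
Qed.

End haar_on_cubes.

(** * Gram matrix and Bessel bound of the differences, for a fixed translation direction *)

Section translated_haar.
Variables (R : realType) (d : nat).
Local Notation mu := (lebesgue_row R d).
Local Notation r := (Num.sqrt (2 : R)).
Variable h0 : 'I_(2 ^ d).-1 -> 'rV[R]_d -> R.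
Hypothesis h0P : forall k, haar_products (h0 k).
Local Notation h := (haar h0).
Variables (eta : R) (v : 'rV[R]_d).
Hypothesis eta01 : 0 < eta < 2^-1.
Hypothesis v1 : forall i, -1 <= v ord0 i <= 1.
Local Notation index := (dyadic d * 'I_(2 ^ d).-1)%type.
Implicit Types p q : index.

Definition haar_shift_diff p (x : 'rV[R]_d) : R :=
  h p.1 p.2 x - h p.1 p.2 (x - (eta * side R p.1) *: v).
Local Notation g := haar_shift_diff.

Lemma integrable_haar_shift_diff p : mu.-integrable setT (EFin \o g p).
Proof.
by apply: integrableB_EFin; [|apply: integrable_shift]; exact: integrable_haar.
Qed.

Lemma square_integrable_haar_shift_diff p : square_integrable mu (g p).
Proof.
apply: square_integrableB; first exact: square_integrable_haar.
exact/square_integrable_shift/square_integrable_haar.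
Qed.

Lemma haar_shift_diff_L1 p :
  \int[mu]_x `|g p x| <=
  6 * d%:R * 3 ^+ d * L2_scale R p.1 * side R p.1 ^+ d * eta.
Proof.
have /andP[eta0 eta1] := eta01; have S0 := side_gt0 R p.1.
apply: (le_trans (@haar_modulus _ _ _ h0P _ _ _ (eta * side R p.1) _ _)).
- by rewrite mulr_gt0//= ler_piMl ?ltW//; lra.
- move=> i; rewrite mxE normrM gtr0_norm ?mulr_gt0// ler_piMr ?(ltW (mulr_gt0 eta0 S0))//.
  by rewrite ler_norml.
- by rewrite mulfK// gt_eqF.
Qed.

(** The two translations commute, so [g p x - g p (x - s)] is a difference of two translates of the
    same [s]-difference of the Haar function; hence the factor [2]. *)
Lemma haar_shift_diff_modulus p (s : 'rV[R]_d) (rho : R) : 0 < rho <= side R p.1 ->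
  (forall i, `|s ord0 i| <= rho) ->
  \int[mu]_x `|g p x - g p (x - s)| <=
  2 * (6 * d%:R * 3 ^+ d * L2_scale R p.1 * side R p.1 ^+ d * (rho / side R p.1)).
Proof.
move=> rhoP srho; pose t := (eta * side R p.1) *: v.
pose f x := `|h p.1 p.2 x - h p.1 p.2 (x - s)|.
have ih := integrable_haar h0P p.1 p.2.
have if_ : mu.-integrable setT (EFin \o f).
  by apply/integrable_norm/integrableB_EFin => //; exact: integrable_shift.
have ig := integrable_haar_shift_diff p.
apply: (@le_trans _ _ (\int[mu]_x (f x + f (x - t)))).
  apply: le_Rintegral => //.
  - by apply/integrable_norm/integrableB_EFin => //; exact: integrable_shift.
  - by apply: integrableD_EFin => //; exact: integrable_shift.
  - move=> x _; rewrite /f /g -/t [x - s - t]addrAC.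
    apply: le_trans (ler_normB _ _).
    by rewrite le_eqVlt; apply/orP; left; apply/eqP; congr `|_|; ring.
rewrite RintegralD//; last exact: integrable_shift.
rewrite (Rintegral_shift (- t) if_) mulr_natl mulr2n.
by apply: lerD; exact: haar_modulus.
Qed.

(** All indices of scale [n] share the shift [t], so the Haar sum is used at the two points [x] and
    [x - t]. *)
Lemma sum_haar_shift_diff_le (n : int) (s : seq index) x : uniq s ->
  \sum_(q <- s | q.1.1 == n) `|g q x| <=
  2 * ((2 ^ d).-1%:R * r ^ (- (n * d%:Z))).
Proof.
move=> us; pose t : 'rV[R]_d := (eta * 2 ^ n) *: v.
apply: (@le_trans _ _ (\sum_(q <- s | q.1.1 == n) `|h q.1 q.2 x| +
    \sum_(q <- s | q.1.1 == n) `|h q.1 q.2 (x - t)|)).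
  rewrite -big_split/=; apply: ler_sum => -[[m j] k] /= /eqP ->.
  exact: ler_normB.
by rewrite mulr_natl mulr2n; apply: lerD; exact: sum_haar_le.
Qed.

(* At finer scales the translation is moved from [h_q] onto [g_p]. *)
Lemma gram_fine_scale p (n : int) (s : seq index) : uniq s -> n <= p.1.1 ->
  \sum_(q <- s | q.1.1 == n) `|\int[mu]_x (g p x * g q x)| <=
  (2 ^ d).-1%:R * r ^ (- (n * d%:Z)) *
  (2 * (6 * d%:R * 3 ^+ d * L2_scale R p.1 * side R p.1 ^+ d *
        (eta * 2 ^ n / side R p.1))).
Proof.
move=> us np; pose t : 'rV[R]_d := (eta * 2 ^ n) *: v.
have /andP[eta0 eta1] := eta01.
(* Written with a double negation to match [haar_shift_diff_modulus] at [s := - t]. *)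
pose G x := g p x - g p (x - - t).
have ig := integrable_haar_shift_diff p.
have g2 := square_integrable_haar_shift_diff p.
have iG : mu.-integrable setT (EFin \o G).
  by apply: integrableB_EFin => //; exact: integrable_shift.
have G2 : square_integrable mu G.
  by apply: square_integrableB => //; exact: square_integrable_shift.
have h2 q : square_integrable mu (h q.1 q.2) by exact: square_integrable_haar.
have E q : q.1.1 = n -> \int[mu]_x (g p x * g q x) =
    \int[mu]_x (G x * h q.1 q.2 x).
  move=> qn; rewrite /G.
  under eq_Rintegral do rewrite {2}/haar_shift_diff mulrBr.
  under [RHS]eq_Rintegral do rewrite mulrBl.
  have g2t := square_integrable_shift (- - t) g2.
  have h2t := square_integrable_shift (- t) (h2 q).
  rewrite /side qn -/t RintegralB//; [|exact: square_integrableM..].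
  rewrite RintegralB//; [|exact: square_integrableM..].
  congr (_ - _); rewrite -[RHS](Rintegral_shift (- t)); last first.
    exact: square_integrableM.
  by apply: eq_Rintegral => x _; rewrite opprK subrK.
rewrite (eq_bigr (fun q => `|\int[mu]_x (G x * h q.1 q.2 x)|)); last first.
  by move=> q /eqP qn; rewrite E.
rewrite -big_filter; apply: (le_trans (sum_abs_Rintegral_le iG (u := fun q => h q.1 q.2)
  (M := (2 ^ d).-1%:R * r ^ (- (n * d%:Z))) _ _)).
- by move=> q; exact: square_integrableM.
- by move=> x; rewrite big_filter; exact: sum_haar_le.
- apply: ler_wpM2l; first by rewrite mulr_ge0// exprz_ge0.
  apply: haar_shift_diff_modulus.
    rewrite mulr_gt0 ?exprz_gt0//=.
    apply: (@le_trans _ _ (2 ^ n)); first by rewrite ler_piMl ?exprz_ge0//; lra.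
    by rewrite /side ler_eXz2l// ltr1n.
  move=> i; rewrite mxE mxE normrN normrM gtr0_norm ?mulr_gt0 ?exprz_gt0//.
  by rewrite ler_piMr ?mulr_ge0 ?exprz_ge0 ?(ltW eta0)// ler_norml.
Qed.

(** The [g q] are bounded pointwise and [eta] comes from the L^1 norm of [g p]; the factor
    [r ^ (- (n * d%:Z))] decays as the scale [n] becomes coarser. *)
Lemma gram_coarse_scale p (n : int) (s : seq index) : uniq s ->
  \sum_(q <- s | q.1.1 == n) `|\int[mu]_x (g p x * g q x)| <=
  2 * ((2 ^ d).-1%:R * r ^ (- (n * d%:Z))) *
  (6 * d%:R * 3 ^+ d * L2_scale R p.1 * side R p.1 ^+ d * eta).
Proof.
move=> us; have ig := integrable_haar_shift_diff p.
rewrite -big_filter; apply: (le_trans (sum_abs_Rintegral_le ig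
  (M := 2 * ((2 ^ d).-1%:R * r ^ (- (n * d%:Z)))) _ _)).
- by move=> q; apply: square_integrableM; exact: square_integrable_haar_shift_diff.
- by move=> x; rewrite big_filter; exact: sum_haar_shift_diff_le.
- apply: ler_wpM2l; first by rewrite !mulr_ge0// exprz_ge0.
  exact: haar_shift_diff_L1.
Qed.

(* [side ^ ((d - 1) / 2)]: the exponent is such that the weighted row sums of the
   Gram matrix decay both towards finer and towards coarser scales. *)
Definition haar_weight p : R := r ^ (p.1.1 * (d%:Z - 1)).

Lemma haar_weight_gt0 p : 0 < haar_weight p.
Proof. by rewrite exprz_gt0// sqrtr_gt0. Qed.

(** Exponents of [r], with m the scale of [p]: the coarse bound gives -nd + md + n(d - 1) = m(d - 1)
    - (n - m); the fine one adds 2n - 2m and gives m(d - 1) - (m - n). *)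
Lemma gram_scale p (n : int) (s : seq index) : uniq s ->
  \sum_(q <- s | q.1.1 == n) `|\int[mu]_x (g p x * g q x)| * haar_weight q <=
  12 * d%:R * 3 ^+ d * (2 ^ d).-1%:R * eta * haar_weight p *
  r^-1 ^+ `|p.1.1 - n|%N.
Proof.
move=> us; have r0 : 0 < r by rewrite sqrtr_gt0.
have ru : r \is a GRing.unit by rewrite unitfE gt_eqF.
rewrite (eq_bigr (fun q => `|\int[mu]_x (g p x * g q x)| * r ^ (n * (d%:Z - 1)))); last first.
  by move=> q /eqP <-.
rewrite -mulr_suml; set m := p.1.1.
have rV : r^-1 ^+ `|m - n|%N = r ^ (- `|m - n|).
  by rewrite exprnP exprz_inv abszE.
have LE : L2_scale R p.1 * side R p.1 ^+ d = r ^ (m * d%:Z).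
  rewrite L2_scaleE sideE exprnP exprz_exp -exprzDr//; congr (_ ^ _).
  by rewrite /m; lia.
rewrite rV /haar_weight -/m.
have [np|pn] := leP n m.
  apply: (le_trans (ler_wpM2r (exprz_ge0 _ (ltW r0)) (gram_fine_scale us np))).
  have -> : eta * 2 ^ n / side R p.1 = eta * r ^ (2 * n - 2 * m).
    rewrite sideE -/m -[2 ^ n](_ : r ^ (2 * n) = _); last first.
      by rewrite -exprz_exp -exprnP sqr_sqrtr.
    by rewrite invr_expz -mulrA -exprzDr.
  rewrite -!mulrA [_ * (side R _ ^+ _ * _)]mulrA LE le_eqVlt; apply/orP; left; apply/eqP.
  have -> : r ^ (m * (d%:Z - 1)) * r ^ (- `|m - n|) = 
     r ^ (- (n * d%:Z)) * r ^ (m * d%:Z) * r ^ (2 * n - 2 * m) * r ^ (n * (d%:Z - 1)).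
    rewrite -!exprzDr//; congr (_ ^ _).
    by rewrite ger0_norm ?subr_ge0//; lia.
  by ring.
apply: (le_trans (ler_wpM2r (exprz_ge0 _ (ltW r0)) (gram_coarse_scale p n us))).
rewrite -!mulrA [_ * (side R _ ^+ _ * _)]mulrA LE le_eqVlt; apply/orP; left; apply/eqP.
have -> : r ^ (m * (d%:Z - 1)) * r ^ (- `|m - n|) = 
     r ^ (- (n * d%:Z)) * r ^ (m * d%:Z) * r ^ (n * (d%:Z - 1)).
  rewrite -!exprzDr//; congr (_ ^ _).
  by rewrite ltr0_norm ?subr_lt0//; lia.
by ring.
Qed.

(** The constant of [gram_scale] times the two-sided geometric series of ratio [r^-1]. *)
Definition haar_bessel_constant : R :=
  12 * d%:R * 3 ^+ d * (2 ^ d).-1%:R * (2 / (1 - r^-1)).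

Lemma haar_bessel_constant_gt0 : (0 < d)%N -> 0 < haar_bessel_constant.
Proof.
move=> d0; have r1 : 1 < r by rewrite -[ltLHS]sqrtr1 ltr_sqrt// ltr1n.
rewrite /haar_bessel_constant mulr_gt0//; last first.
  by rewrite divr_gt0// subr_gt0 invf_lt1// (lt_trans ltr01).
rewrite !mulr_gt0 ?exprn_gt0 ?ltr0n// -subn1 subn_gt0.
by case: d d0 => // n _; rewrite -{1}(expn0 2) ltn_exp2l.
Qed.

Lemma bessel_haar_shift_diff (s : seq index) (f : 'rV[R]_d -> R) :
  (0 < d)%N -> uniq s -> square_integrable mu f ->
  \sum_(p <- s) (\int[mu]_x (f x * g p x)) ^+ 2 <=
  haar_bessel_constant * eta * \int[mu]_x f x ^+ 2.
Proof.
move=> d0 us; have /andP[eta0 _] := eta01.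
have r1 : 1 < r by rewrite -[ltLHS]sqrtr1 ltr_sqrt// ltr1n.
have rV01 : 0 <= r^-1 < 1 by rewrite invr_ge0 sqrtr_ge0 invf_lt1// (lt_trans ltr01).
have K0 := haar_bessel_constant_gt0 d0.
apply: (bessel_le_of_gram (mulr_gt0 K0 eta0)).
  exact: square_integrable_haar_shift_diff.
apply: (schur_test haar_weight_gt0).
  by move=> p q; under eq_Rintegral do rewrite mulrC.
move=> p ps; rewrite (sum_fibers _ (fun q : index => q.1.1)).
apply: (@le_trans _ _ (\sum_(n <- undup [seq q.1.1 | q <- s])
    (12 * d%:R * 3 ^+ d * (2 ^ d).-1%:R * eta * haar_weight p *
      r^-1 ^+ `|p.1.1 - n|%N))).
  by apply: ler_sum => n _; exact: gram_scale.
rewrite -mulr_sumr /haar_bessel_constant.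
have := sum_geometric_abs_le p.1.1 rV01 (undup_uniq [seq q.1.1 | q <- s]).
have cw : 0 <= 12 * d%:R * 3 ^+ d * (2 ^ d).-1%:R * eta * haar_weight p.
  by rewrite !mulr_ge0 ?exprn_ge0 ?(ltW eta0) ?(ltW (haar_weight_gt0 _)).
move=> /(ler_wpM2l cw) /le_trans; apply.
by rewrite le_eqVlt; apply/orP; left; apply/eqP; ring.
Qed.

End translated_haar.

(** * The properties (a), (b), (c) of the smoothed Haar functions *)

Section smooth_haar_properties.
Variables (R : realType) (d : nat).
Local Notation mu := (lebesgue_row R d).
Variable h0 : 'I_(2 ^ d).-1 -> 'rV[R]_d -> R.
Hypothesis h0P : forall k, haar_products (h0 k).
Local Notation h := (haar h0).
Variables (psi : 'rV[R]_d -> R) (eta : R).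
Hypothesis ipsi : mu.-integrable setT (EFin \o psi).
Hypothesis psi_supp : forall x, psi x != 0 -> forall i, -1 <= x ord0 i <= 1.
Hypothesis psi1 : \int[mu]_x psi x = 1.
Hypothesis eta01 : 0 < eta < 2^-1.
Implicit Types (Q : dyadic d) (k : 'I_(2 ^ d).-1).
Local Notation phi := (smooth_haar h0 psi eta).

Lemma measurable_row_reflect (x : 'rV[R]_d) (c : R) :
  measurable_fun setT (fun y : 'rV[R]_d => x - c *: y).
Proof.
apply: measurable_fun_rowP => i; under eq_fun do rewrite !mxE.
apply: measurable_funB => //; apply: measurable_funM => //.
exact: (@measurable_coord _ R).
Qed.

Lemma integrable_haar_psi Q k (x : 'rV[R]_d) (c : R) :
  mu.-integrable setT (EFin \o (fun y => h Q k (x - c *: y) * psi y)).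
Proof.
apply: (le_integrable_EFin _ _ (integrableZ_EFin (L2_scale R Q) ipsi)).
  apply: measurable_funM; last exact: measurable_EFin_integrable ipsi.
  by apply: (measurableT_comp (measurable_haar h0P Q k)); exact: measurable_row_reflect.
move=> y; rewrite [leLHS]normrM [leRHS]normrM ler_wpM2r// (le_trans (haar_norm_le h0P _ _ _))//.
by rewrite gtr0_norm ?L2_scale_gt0// ler_piMr ?(ltW (L2_scale_gt0 _ _)).
Qed.

(** The normalization of the dilation cancels the Jacobian. In this form the averaging density [psi]
    is the same for all cubes, which allows one averaging argument for the whole family. *)
Lemma smooth_haarE Q k x :
  phi Q k x = \int[mu]_y (h Q k (x - (eta * side R Q) *: y) * psi y).
Proof.
have /andP[eta0 _] := eta01; have s0 := side_gt0 R Q.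
have c0 : 0 < eta * side R Q by rewrite mulr_gt0.
have cV0 : 0 < (eta * side R Q)^-1 by rewrite invr_gt0.
rewrite -(Rintegral_row_affine 0 cV0 (integrable_haar_psi Q k x _)).
rewrite -RintegralZl//; last exact: (integrable_row_affine _ _ (integrable_haar_psi _ _ _ _)).
apply: eq_Rintegral => y _; rewrite /dilation !addr0 scalerA divff ?gt_eqF// scale1r.
by rewrite exprVn mulrCA.
Qed.

Lemma smooth_haar_scale Q k x :
  phi Q k x = L2_scale R Q * phi (unit_dyadic d) k (to_unit Q x).
Proof.
rewrite !smooth_haarE -RintegralZl//; last exact: integrable_haar_psi.
apply: eq_Rintegral => y _; rewrite mulrA; congr (_ * _).
rewrite haar_unit_dyadic /haar; congr (_ * h0 k _).
apply/rowP => i; rewrite !mxE /side/= expr0z mulr1 mulrBr.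
have -> : 2 ^ (- Q.1) * (eta * 2 ^ Q.1 * y ord0 i) = eta * y ord0 i :> R.
  by rewrite -invr_expz; field; rewrite expfz_neq0.
by rewrite addrAC.
Qed.

Lemma smooth_haar_supp Q k x : ~ dilated_cube (1 + 2 * eta) Q x -> phi Q k x = 0.
Proof.
have /andP[eta0 _] := eta01; have s0 := side_gt0 R Q.
move=> xQ; rewrite smooth_haarE; under eq_Rintegral => y _.
  rewrite (_ : _ * _ = 0); last first.
    apply/eqP; rewrite mulf_eq0; apply/negPn; rewrite negb_or.
    apply/negP => /andP[/(haar_supp h0P) Qxy /psi_supp y1]; apply: xQ.
    (* Contract [x] towards the center: its coordinates exceed those of a point of [Q] by at most
       eta l(Q), and (1/2 + eta) l(Q) is half the side of the dilated cube. *)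
    exists (Defs.center R Q + (1 + 2 * eta)^-1 *: (x - Defs.center R Q)); last first.
      rewrite addrAC subrr add0r scalerA divff ?scale1r ?subrKC//.
      by rewrite gt_eqF//; lra.
    move=> i; have := Qxy i; have := y1 i; rewrite !mxE.
    set c := _%:~R; set yi := y ord0 i; set xi := x ord0 i; set s := side R Q.
    move=> /andP[yi1 yi2] /andP[xy1 xy2].
    have l0 : 0 < 1 + 2 * eta by lra.
    have es0 : 0 < eta * s by rewrite mulr_gt0.
    have esy1 : - (eta * s) <= eta * s * yi by nra.
    have esy2 : eta * s * yi <= eta * s by nra.
    rewrite [(1 + _)^-1 * _]mulrC; apply/andP; split.
      by rewrite -lerBlDl ler_pdivlMr//; nra.
    by rewrite -ltrBrDl ltr_pdivrMr//; nra.
  over.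
by rewrite Rintegral_cst// mul0r.
Qed.

(** Were the function continuous at all points of the segment, it would take intermediate values
    there, but it has only three values. *)
Lemma discontinuity_on_segment Q k (x w : 'rV[R]_d) :
  h Q k (x + w) != h Q k x ->
  exists2 t : R, 0 <= t <= 1 & discontinuities (h Q k) (x + t *: w).
Proof.
move=> hxw; apply: contrapT => /forall2NP H.
pose f t := h Q k (x + t *: w).
have L0 := L2_scale_gt0 R Q.
have cf : {within `[0, 1], continuous f}.
  apply: continuous_in_subspaceT => t; rewrite inE/= in_itv/= => t01.
  have [/(_ t01)//|ct] := H t.
  have {}ct : {for x + t *: w, continuous (h Q k)} by apply: contrapT.
  apply: (@continuous_comp _ _ _ (fun t : R => x + t *: w) (h Q k)); last exact: ct.
  apply: continuousD; first exact: cst_continuous.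
  exact: scalel_continuous.
have f0 : f 0 = h Q k x by rewrite /f scale0r addr0.
have f1 : f 1 = h Q k (x + w) by rewrite /f scale1r.
(* A quarter of the way and not half: the midpoint of the two extreme values is [0], which is itself
   a value. *)
have [|c _] := @IVT R f 0 1 (f 0 + (f 1 - f 0) / 4) ler01 cf.
  rewrite ge_min le_max; case: (leP (f 0) (f 1)) => ?; apply/andP; split; apply/orP; lra.
have := haar_values h0P Q k (x + c *: w); rewrite -/(f c).
move: hxw; rewrite -f0 -f1 f0 f1.
have := haar_values h0P Q k (x + w).
have := haar_values h0P Q k x.
by move=> [->|->|->] [->|->|->]; rewrite ?eqxx// => _ [] ->; lra.
Qed.

(** Comparison of the Euclidean norm with the maximum norm; this is the origin of c(d), the square
    root of [d]. *)
Lemma euclidean_dist_scale_le (x w : 'rV[R]_d) (t rho : R) : 0 <= t <= 1 ->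
  0 <= rho -> (forall i, `|w ord0 i| <= rho) ->
  euclidean_dist x (x + t *: w) <= Num.sqrt d%:R * rho.
Proof.
move=> t01 rho0 wrho; rewrite -[rho]ger0_norm// -sqrtr_sqr -sqrtrM//.
apply: ler_wsqrtr.
rewrite -[d in d%:R]card_ord -sum1_card natr_sum mulr_suml.
apply: ler_sum => i _; rewrite !mxE mul1r opprD addrA subrr sub0r sqrrN.
have := wrho i; rewrite ler_norml => /andP[w1 w2].
rewrite -[leLHS]real_normK ?num_real// lerXn2r ?nnegrE//.
rewrite normrM -[leRHS]mul1r ler_pM// ?wrho//.
by rewrite ger0_norm; case/andP: t01.
Qed.

(** If some [y] with [psi y != 0] gave another value than [h Q k x], the segment from [x] to
    [x - (eta * side R Q) *: y] would contain a discontinuity too close to [x]. *)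
Lemma smooth_haar_eq Q k x :
  Num.sqrt d%:R * eta * side R Q < dist_to_set (discontinuities (h Q k)) x ->
  phi Q k x = h Q k x.
Proof.
have /andP[eta0 _] := eta01; have s0 := side_gt0 R Q.
move=> xD; rewrite smooth_haarE -[RHS]mulr1 -psi1 -RintegralZl//.
apply: eq_Rintegral => y _; have [->|/psi_supp y1] := eqVneq (psi y) 0.
  by rewrite !mulr0.
congr (_ * _); apply/eqP/negPn/negP => /discontinuity_on_segment[t t01 tD].
move: xD; rewrite ltNge => /negP; apply.
apply: (@le_trans _ _ (euclidean_dist x (x + t *: - ((eta * side R Q) *: y)))).
  apply: ge_inf; last by exists (x + t *: - ((eta * side R Q) *: y)).
  by exists 0 => _ [z _ <-]; exact: sqrtr_ge0.
rewrite -mulrA; apply: euclidean_dist_scale_le => //.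
  by rewrite mulr_ge0 ?ltW.
move=> i; rewrite !mxE normrN normrM gtr0_norm ?mulr_gt0//.
by rewrite ler_piMr ?(ltW (mulr_gt0 eta0 s0))// ler_norml.
Qed.

End smooth_haar_properties.

(** * From a fixed translation to the average over [psi] *)

Section averaging.
Variables (R : realType) (d : nat).
Local Notation mu := (lebesgue_row R d).
Variable h0 : 'I_(2 ^ d).-1 -> 'rV[R]_d -> R.
Hypothesis h0P : forall k, haar_products (h0 k).
Local Notation h := (haar h0).
Variables (psi : 'rV[R]_d -> R) (eta : R).
Hypothesis ipsi : mu.-integrable setT (EFin \o psi).
Hypothesis psi_ge0 : forall x, 0 <= psi x.
Hypothesis psi_supp : forall x, psi x != 0 -> forall i, -1 <= x ord0 i <= 1.
Hypothesis psi1 : \int[mu]_x psi x = 1.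
Hypothesis eta01 : 0 < eta < 2^-1.
Local Notation index := (dyadic d * 'I_(2 ^ d).-1)%type.
Implicit Types p q : index.
Local Notation g y := (haar_shift_diff h0 eta y).

Definition smooth_haar_error p (x : 'rV[R]_d) : R :=
  h p.1 p.2 x - smooth_haar h0 psi eta p.1 p.2 x.
Local Notation err := smooth_haar_error.

(** Dominates [g y p] for all [y] in [-1, 1]^d at once: the cube is fattened by its side length in
    each direction, more than any shift eta l(Q) y. *)
Definition haar_majorant p (x : 'rV[R]_d) : R :=
  2 * L2_scale R p.1 *
  \1_(row_box (\row_i (((p.1.2 ord0 i)%:~R - 1) * side R p.1))
              (\row_i (((p.1.2 ord0 i)%:~R + 2) * side R p.1))) x.
Local Notation H := haar_majorant.

Lemma haar_majorant_ge0 p x : 0 <= H p x.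
Proof. by rewrite !mulr_ge0// ltW// L2_scale_gt0. Qed.

Lemma square_integrable_haar_majorant p : square_integrable mu (H p).
Proof.
apply/square_integrableZ/square_integrable_indic_row_box => i.
by rewrite !mxE ler_pM2r ?side_gt0//; lra.
Qed.

Lemma haar_shift_diff_le_majorant p (x y : 'rV[R]_d) :
  (forall i, -1 <= y ord0 i <= 1) -> `|g y p x| <= H p x.
Proof.
have /andP[eta0 eta1] := eta01; have s0 := side_gt0 R p.1.
have L0 := L2_scale_gt0 R p.1.
have es0 : 0 < eta * side R p.1 by rewrite mulr_gt0.
have es1 : eta * side R p.1 <= side R p.1 by rewrite ler_piMl ?(ltW s0)//; lra.
move=> y1; have [->|gx] := eqVneq (g y p x) 0.
  by rewrite normr0 haar_majorant_ge0.
rewrite /haar_majorant indicE mem_set; last first.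
  move=> i; rewrite !mxE.
  have := y1 i; move: (s0) (es0) (es1); set c := _%:~R; set s := side R p.1.
  set yi := y ord0 i => s0' es0' es1' y1i.
  have [hx|/(haar_supp h0P)/(_ i)] := eqVneq (h p.1 p.2 x) 0; last first.
    by rewrite -/c -/s => /andP[xQ1 xQ2]; apply/andP; split; nra.
  have : h p.1 p.2 (x - (eta * side R p.1) *: y) != 0.
    by move: gx; rewrite /haar_shift_diff hx sub0r oppr_eq0.
  move=> /(haar_supp h0P)/(_ i); rewrite !mxE -/c -/s -/yi => /andP[xQ1 xQ2].
  have /andP[yi1 yi2] := y1i.
  have esy1 : - (eta * s) <= eta * s * yi by nra.
  have esy2 : eta * s * yi <= eta * s by nra.
  by apply/andP; split; nra.
have hL z : `|h p.1 p.2 z| <= L2_scale R p.1.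
  by apply: (le_trans (haar_norm_le h0P _ _ _)); rewrite ler_piMr ?(ltW L0).
rewrite mulr1 mulr_natl mulr2n; apply: (le_trans (ler_normB _ _)).
by apply: lerD.
Qed.

Lemma haar_shift_diff_psi_le p (x y : 'rV[R]_d) :
  `|g y p x * psi y| <= H p x * psi y.
Proof.
have [->|/psi_supp y1] := eqVneq (psi y) 0; first by rewrite !mulr0 normr0.
by rewrite normrM (ger0_norm (psi_ge0 y)) ler_wpM2r// haar_shift_diff_le_majorant.
Qed.

Lemma integrable_haar_shift_diff_psi p x :
  mu.-integrable setT (EFin \o (fun y => g y p x * psi y)).
Proof.
under [X in mu.-integrable _ (EFin \o X)]eq_fun do rewrite mulrBl.
apply: integrableB_EFin; last exact: integrable_haar_psi.
exact: integrableZ_EFin.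
Qed.

Lemma smooth_haar_errorE p x : err p x = \int[mu]_y (g y p x * psi y).
Proof.
under eq_Rintegral do rewrite mulrBl.
rewrite RintegralB//; [|exact: integrableZ_EFin|exact: integrable_haar_psi].
by rewrite RintegralZl// psi1 mulr1 /err (smooth_haarE h0P ipsi eta01).
Qed.

Lemma smooth_haar_error_le p x : `|err p x| <= H p x.
Proof.
rewrite smooth_haar_errorE; have ig := integrable_haar_shift_diff_psi p x.
apply: (le_trans (le_normr_Rintegral measurableT ig)).
rewrite -[leRHS]mulr1 -psi1 -RintegralZl//; apply: le_Rintegral => //.
- exact: integrable_norm.
- exact: integrableZ_EFin.
- by move=> y _; exact: haar_shift_diff_psi_le.
Qed.

Section fixed_function.
Variable f : 'rV[R]_d -> R.
Hypothesis f2 : square_integrable mu f.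

Let K p (z : 'rV[R]_d * 'rV[R]_d) : \bar R :=
  (f z.2 * (g z.1 p z.2 * psi z.1))%:E.

Let measurable_K p : measurable_fun setT (K p).
Proof.
apply/measurable_EFinP; apply: measurable_funM.
  by apply: measurableT_comp; [case: f2|].
apply: measurable_funM; last first.
  by apply: measurableT_comp => //; exact: measurable_EFin_integrable ipsi.
apply: measurable_funB.
  by apply: measurableT_comp => //; exact: measurable_haar.
apply: (measurableT_comp (measurable_haar h0P p.1 p.2)).
apply: measurable_fun_rowP => i; under eq_fun do rewrite !mxE.
apply: measurable_funB.
  exact: (measurableT_comp (@measurable_coord _ R d i)).
apply: measurable_funM => //.
exact: (measurableT_comp (@measurable_coord _ R d i)).
Qed.

(** Tonelli: for fixed [x] the integral of [|K p|] over [y] is at most [|f x| * H p x], a product of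
    two square-integrable functions. *)
Let integrable_K p : (mu \x mu)%E.-integrable setT (K p).
Proof.
apply/integrable21ltyP => //.
pose F x := `|f x| * H p x.
have iF : mu.-integrable setT (EFin \o F).
  apply: square_integrableM; last exact: square_integrable_haar_majorant.
  apply: le_square_integrable f2; last by move=> x; rewrite normr_id.
  by apply: measurableT_comp => //; case: f2.
have F0 x : 0 <= F x by rewrite mulr_ge0// haar_majorant_ge0.
apply: (@le_lt_trans _ _ (\int[mu]_x (F x)%:E)%E); last first.
  exact: (integrable_lty measurableT iF).
apply: ge0_le_integral => //.
- by move=> x _; exact: integral_ge0.
- apply: (measurable_fun_fubini_tonelli_G (fun z => `|K p z|%E)) => //.
  exact: measurableT_comp.
- exact: (measurable_int _ iF).
move=> x _; apply: (@le_trans _ _ (\int[mu]_y ((F x * psi y)%:E))%E).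
  apply: ge0_le_integral => //.
  - apply: measurableT_comp => //; apply: (measurableT_comp (measurable_K p)).
    exact: measurable_fun_pair.
  - exact: (measurable_int _ (integrableZ_EFin (F x) ipsi)).
  - move=> y _; rewrite lee_fin normrM /F -mulrA ler_wpM2l//.
    exact: haar_shift_diff_psi_le.
rewrite le_eqVlt; apply/orP; left; apply/eqP; rewrite -[LHS]fineK; last first.
  exact: (integrable_fin_num measurableT (integrableZ_EFin (F x) ipsi)).
by congr EFin; rewrite -[RHS]mulr1 -psi1 -RintegralZl.
Qed.

Let inner_y p x :
  (\int[mu]_y K p (y, x))%E = (f x * err p x)%:E.
Proof.
have iK := integrableZ_EFin (f x) (integrable_haar_shift_diff_psi p x).
rewrite -[LHS]fineK; last exact: (integrable_fin_num measurableT iK).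
by rewrite smooth_haar_errorE -RintegralZl//; exact: integrable_haar_shift_diff_psi.
Qed.

Let inner_x p y :
  (\int[mu]_x K p (y, x))%E = (psi y * \int[mu]_x (f x * g y p x))%:E.
Proof.
have ifg : mu.-integrable setT (EFin \o (fun x => f x * g y p x)).
  by apply: square_integrableM => //; exact: square_integrable_haar_shift_diff.
rewrite -RintegralZl// /Rintegral fineK.
  by apply: eq_integral => x _; congr EFin; rewrite /=; ring.
exact: (integrable_fin_num measurableT (integrableZ_EFin (psi y) ifg)).
Qed.

Lemma Rintegral_smooth_haar_error p :
  \int[mu]_x (f x * err p x) =
  \int[mu]_y (psi y * \int[mu]_x (f x * g y p x)).
Proof.
have := Fubini (integrable_K p).
under eq_integral do rewrite inner_x.
under [X in _ = X -> _]eq_integral do rewrite inner_y.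
by move=> /(congr1 fine).
Qed.

Lemma integrable_psi_inner p :
  mu.-integrable setT (EFin \o (fun y => psi y * \int[mu]_x (f x * g y p x))).
Proof.
have := integrable_fubini_F (integrable_K p).
by rewrite /fubini_F; under eq_fun do rewrite inner_x.
Qed.

(** This product is a partial integral of [K p], hence measurable by Fubini; the factor [f] is
    divided out later for a suitable choice of it. *)
Lemma measurable_mul_smooth_haar_error p : measurable_fun setT (fun x => f x * err p x).
Proof.
apply/measurable_EFinP.
have := measurable_fubini_G (integrable_K p).
by rewrite /fubini_G; under eq_fun do rewrite inner_y.
Qed.

(* With [a p] the mean of [b p] for the density [psi], sum [2 a b <= a^2 + b^2] over
   [p] and integrate against [psi]. *)
Lemma bessel_smooth_haar_error (s : seq index) : (0 < d)%N -> uniq s ->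
  \sum_(p <- s) (\int[mu]_x (f x * err p x)) ^+ 2 <=
  haar_bessel_constant R d * eta * \int[mu]_x f x ^+ 2.
Proof.
move=> d0 us; set B := leRHS.
pose a p := \int[mu]_x (f x * err p x).
pose b p y := \int[mu]_x (f x * g y p x).
have ib p : mu.-integrable setT (EFin \o (fun y => psi y * b p y)).
  exact: integrable_psi_inner.
pose S := \sum_(p <- s) a p ^+ 2.
have E : 2 * S = \int[mu]_y (\sum_(p <- s) 2 * a p * (psi y * b p y)).
  rewrite Rintegral_sum; last by move=> p; exact: integrableZ_EFin.
  rewrite /S mulr_sumr; apply: eq_bigr => p _.
  by rewrite RintegralZl// -Rintegral_smooth_haar_error expr2 mulrA.
(* As [psi] has integral 1, the right side is [S + B], and [S <= B] follows. *)
have : 2 * S <= \int[mu]_y ((S + B) * psi y).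
  rewrite E; apply: le_Rintegral => //.
  - by apply: integrable_sum_EFin => p; exact: integrableZ_EFin.
  - exact: integrableZ_EFin.
  move=> y _; have [->|/psi_supp y1] := eqVneq (psi y) 0.
    by rewrite mulr0 big1// => p _; rewrite mul0r mulr0.
  under eq_bigr do rewrite mulrCA [psi y * _]mulrC.
  rewrite -mulr_suml ler_wpM2r//.
  apply: (@le_trans _ _ (\sum_(p <- s) (a p ^+ 2 + b p y ^+ 2))).
    by apply: ler_sum => p _; have := sqr_ge0 (a p - b p y); nra.
  by rewrite big_split lerD2l; exact: bessel_haar_shift_diff.
by rewrite RintegralZl// psi1 mulr1 -/S; lra.
Qed.

End fixed_function.

Lemma square_integrable_smooth_haar_error p : square_integrable mu (err p).
Proof.
apply: (@le_square_integrable _ _ _ _ _ (H p)); last first.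
- exact: square_integrable_haar_majorant.
- by move=> x; rewrite (le_trans (smooth_haar_error_le p x))// ler_norm.
have L0 := L2_scale_gt0 R p.1.
(* Measurability is known only after multiplication by some [f]. Take [f := H p]: it is constant on
   its box, and [err p] vanishes off that box. *)
rewrite (_ : err p = fun x => (2 * L2_scale R p.1)^-1 * (H p x * err p x)).
  apply: measurable_funM => //; apply: measurable_mul_smooth_haar_error.
  exact: square_integrable_haar_majorant.
apply/funext => x; have := smooth_haar_error_le p x; rewrite /haar_majorant indicE.
case: (_ \in _); last first.
  by rewrite mulr0 normr_le0 => /eqP ->; rewrite !mulr0.
by move=> _; rewrite mulr1; field; rewrite gt_eqF.
Qed.

End averaging.

(** * Passage to complex-valued test functions *)

Section complex_bessel.
Variables (R : realType) (d : nat).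
Local Notation mu := (lebesgue_row R d).

Lemma sqr_normc (z : R[i]) :
  Normc.normc z ^+ 2 = complex.Re z ^+ 2 + complex.Im z ^+ 2.
Proof. by case: z => a b; rewrite sqr_sqrtr// addr_ge0 ?sqr_ge0. Qed.

Lemma square_integrable_Re_Im (f : 'rV[R]_d -> R[i]) : L2 f ->
  square_integrable mu (fun x => complex.Re (f x)) /\
  square_integrable mu (fun x => complex.Im (f x)).
Proof.
move=> [mr mi foo].
have mfr : measurable_fun setT (fun x => complex.Re (f x) ^+ 2) by exact: measurable_funX.
have mfi : measurable_fun setT (fun x => complex.Im (f x) ^+ 2) by exact: measurable_funX.
have ifn : mu.-integrable setT
    (EFin \o (fun x => complex.Re (f x) ^+ 2 + complex.Im (f x) ^+ 2)).
  apply/integrableP; split; first exact/measurable_EFinP/measurable_funD.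
  under eq_integral do rewrite /= ger0_norm ?addr_ge0 ?sqr_ge0// -sqr_normc.
  exact: foo.
by split; split => //; apply: le_integrable_EFin ifn => // x;
  rewrite !ger0_norm ?addr_ge0 ?sqr_ge0// ?lerDl ?lerDr sqr_ge0.
Qed.

Lemma sqr_normc_inner_real (f : 'rV[R]_d -> R[i]) (u : 'rV[R]_d -> R) :
  Normc.normc (inner f (fun x => (u x)%:C)) ^+ 2 =
  (\int[mu]_x (complex.Re (f x) * u x)) ^+ 2 +
  (\int[mu]_x (complex.Im (f x) * u x)) ^+ 2.
Proof.
rewrite sqr_normc; congr (_ ^+ 2 + _ ^+ 2); apply: eq_Rintegral => x _;
  by case: (f x) => a b /=; rewrite ?oppr0; ring.
Qed.

Lemma L2_real (u : 'rV[R]_d -> R) :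
  square_integrable mu u -> L2 (fun x => (u x)%:C).
Proof.
move=> [mu_ u2]; split => //.
apply: le_lt_trans (integrable_lty measurableT u2).
rewrite le_eqVlt; apply/orP; left; apply/eqP; apply: eq_integral => x _.
by rewrite sqr_normc/= expr0n/= addr0.
Qed.

(** For real [u c] the squared modulus of the inner product splits over the real and imaginary parts
    of [f], as does its squared norm, so the real bound passes on with the same [B]. The sum over
    [Gamma] is a supremum of finite sums. *)
Lemma bessel_bound_real (Gamma : choiceType) (u : Gamma -> 'rV[R]_d -> R) (B : R) :
  0 <= B ->
  (forall (s : seq Gamma) f, uniq s -> square_integrable mu f ->
    \sum_(c <- s) (\int[mu]_x (f x * u c x)) ^+ 2 <= B * \int[mu]_x f x ^+ 2) ->
  bessel_bound (fun c x => (u c x)%:C) B.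
Proof.
move=> B0 uB; split => // f /square_integrable_Re_Im[fr fi].
apply: ge_ereal_sup => _ [A [finA _] <-].
rewrite fsbig_finite// sumEFin lee_fin.
under eq_bigr do rewrite sqr_normc_inner_real.
rewrite big_split/= /L2norm2; under eq_Rintegral do rewrite sqr_normc.
rewrite RintegralD//; [|by case: fr|by case: fi].
by rewrite mulrDr; apply: lerD; exact: uB.
Qed.

End complex_bessel.

Theorem theorem1 (R : realType) (d : nat) (d_gt0 : (0 < d)%N) :
  exists C c : R, [/\ 0 < C, 0 < c &
  forall (h0 : 'I_(2 ^ d).-1 -> 'rV[R]_d -> R) (psi : 'rV[R]_d -> R) (eta : R),
    haar_enumeration h0 ->
    (lebesgue_row R d).-integrable setT (EFin \o psi) ->
    (forall x, 0 <= psi x) ->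
    (forall x, psi x != 0 -> forall i, -1 <= x ord0 i <= 1) ->
    \int[lebesgue_row R d]_x psi x = 1 ->
    0 < eta < 2^-1 ->
    let h := haar h0 in
    let phi := smooth_haar h0 psi eta in
    let err := fun (p : dyadic d * 'I_(2 ^ d).-1) (x : 'rV[R]_d) =>
      (h p.1 p.2 x - phi p.1 p.2 x)%:C in
    [/\ bessel_family err /\ AO_norm err < C * Num.sqrt eta,
        forall Q k x, ~ dilated_cube (1 + 2 * eta) Q x -> phi Q k x = 0,
        forall Q k x,
          c * eta * side R Q < dist_to_set (discontinuities (h Q k)) x ->
          phi Q k x = h Q k x &
        forall Q k x,
          phi Q k x = L2_scale R Q * phi (unit_dyadic d) k (to_unit Q x)]].
Proof.
(* The [+ 1] makes the bound on the norm strict. *)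
exists (Num.sqrt (haar_bessel_constant R d) + 1), (Num.sqrt d%:R); split.
- by rewrite ltr_wpDl// sqrtr_ge0.
- by rewrite sqrtr_gt0 ltr0n.
move=> h0 psi eta [_ h0E] ipsi psi_ge0 psi_supp psi1 eta01 h phi err.
have h0P k : haar_products (h0 k) by rewrite -h0E; exists k.
have /andP[eta0 _] := eta01.
have B : bessel_bound err (haar_bessel_constant R d * eta).
  apply: bessel_bound_real => [|s f us f2].
    by rewrite mulr_ge0 ?(ltW eta0) ?(ltW (haar_bessel_constant_gt0 R d_gt0)).
  exact: (bessel_smooth_haar_error h0P ipsi psi_ge0 psi_supp psi1 eta01).
split.
- split.
    split; last by exists (haar_bessel_constant R d * eta).
    move=> p; apply: L2_real.
    exact: (square_integrable_smooth_haar_error h0P ipsi psi_ge0 psi_supp psi1 eta01).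
  apply: (@le_lt_trans _ _ (Num.sqrt (haar_bessel_constant R d * eta))).
    (* The infimum is a genuine one: the set of Bessel bounds contains the one in [B] and is bounded
       below by [0]. *)
    by apply: ler_wsqrtr; apply: ge_inf => //; exists 0 => b [].
  rewrite sqrtrM ?(ltW (haar_bessel_constant_gt0 R d_gt0))// ltr_pM2r ?sqrtr_gt0//.
  by rewrite ltrDl.
- by move=> Q k x; exact: smooth_haar_supp.
- by move=> Q k x; exact: smooth_haar_eq.
- by move=> Q k x; exact: smooth_haar_scale.
Qed.
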